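(* (Limiting Absorption Principle) Suppose that $\rho>0$, $\|V\|_\rho<\infty$ and $\rho+1/2<\alpha$. For either choice of sign $\pm$ and every compact set $K^\pm\subset\overline{\mathbb{C}^\pm}\setminus(\sigma_p(H)\cup\{-2,2\})$, the function $$K^\pm\ni E\mapsto T_{-\alpha}R_H^\pm(E)T_{-\alpha}\in B(\ell^2(\mathbb{Z},\mathcal{M}_L))$$ is Hölder continuous with Hölder exponent $\min(\rho,1)$.
   Context: Fix $L\ge 1$. $\mathcal{M}_L$ is the space of complex $L\times L$ matrices with inner product $\langle A,B\rangle=\operatorname{tr}(B^*A)$. $V=(V(n))_{n\in\mathbb{Z}}$ is a sequence of self-adjoint matrices in $\mathcal{M}_L$; $\|V\|_\rho:=\sum_n(|n|+1)^\rho\|V(n)\|$. For $u\in\mathcal{M}_L^{\mathbb{Z}}$ put $(\tau u)(n)=u(n+1)+u(n-1)+V(n)u(n)$, and let $H$ be the restriction of $\tau$ to $\ell^2(\mathbb{Z},\mathcal{M}_L)$; $H$ is bounded and self-adjoint. $\sigma_p(H)$ is its set of eigenvalues (the spectrum of $H$ is $[-2,2]$ together with finitely many eigenvalues outside $[-2,2]$). $\mathbb{C}^\pm=\{E:\pm\Im E>0\}$ and $\overline{\mathbb{C}^\pm}$ is the closure. $R_H(E)=(H-E)^{-1}$. Kernel: for a bounded operator $\mathcal{K}$ on $\ell^2(\mathbb{Z},\mathcal{M}_L)$, $[\mathcal{K}]_{s,r}=\pi_s\mathcal{K}\pi_r^*\in B(\mathcal{M}_L)$, with $\pi_s(u)=u(s)$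 and $(\pi_r^*A)(n)=\delta_{n,r}A$. For $E\in\mathbb{C}\setminus(\sigma_p(H)\cup\{-2,2\})$ let $[R_H^\pm(E)]_{s,r}=[R_H(E)]_{s,r}$ if $E\notin(-2,2)$, and $[R_H^\pm(E)]_{s,r}=\lim_{\epsilon\to0^+}[R_H(E\pm i\epsilon)]_{s,r}$ if $E\in(-2,2)$ (these limits exist). $R^\pm_H(E)$ is the operator $(R^\pm_H(E)u)(s)=\sum_r[R_H^\pm(E)]_{s,r}u(r)$, defined on those $u\in\mathcal{M}_L^{\mathbb{Z}}$ for which $\sum_r\|[R_H^\pm(E)]_{s,r}u(r)\|<\infty$ for all $s$; its domain contains $\ell^1(\mathbb{Z},\mathcal{M}_L)$ when $E\in(-2,2)$, and it extends $R_H(E)$ when $E\notin(-2,2)$. $(T_{-\alpha}u)(n)=(1+|n|)^{-\alpha}u(n)$ on $\ell^2(\mathbb{Z},\mathcal{M}_L)$. *)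

(* Defs.v *)
From HB Require Import structures.
From mathcomp Require Import all_boot all_order all_algebra.
From mathcomp Require Import all_classical all_reals all_analysis.
From mathcomp Require Import complex.

Set Implicit Arguments.
Unset Strict Implicit.
Unset Printing Implicit Defensive.

Import Order.TTheory GRing.Theory Num.Theory.
Import numFieldNormedType.Exports.

Local Open Scope classical_set_scope.
Local Open Scope complex_scope.
Local Open Scope ring_scope.

(* The regular algebra R[i]^o, unlike R[i] itself, carries the canonical
   topology and norm; on R[i], [x < y] means equal imaginary parts and
   [Re x < Re y], so that [-2 < E < 2] says that E lies in the real segment
   (-2, 2). *)
Notation "'Cplx' R" := (R[i]^o)%type (at level 10, R at level 9).
Notation "'Mat' R L" := 'M[Cplx R]_L
  (at level 10, R at level 9, L at level 9).
Notation "'Seq' R L" := (int -> Mat R L)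
  (at level 10, R at level 9, L at level 9).

Section MatrixSequences.
Context {R : realType} {L : nat}.
Implicit Types (A B : Mat R L) (u v : Seq R L) (T : Seq R L -> Seq R L).

Definition mat_dot A B : Cplx R := \tr ((map_mx Num.conj B)^T *m A).

Definition mat_norm A : R := Num.sqrt (complex.Re (mat_dot A A)).

Definition l2norm u : \bar R :=
  ((\esum_(n in [set: int]) ((mat_norm (u n)) ^+ 2)%:E) `^ 2^-1)%E.

Definition l2 : set (Seq R L) := [set u | (l2norm u < +oo)%E].

Definition opnorm T : \bar R :=
  ereal_sup [set l2norm (T u) | u in [set u | (l2norm u <= 1)%E]].

(* [T], restricted to l2, is an element of B(l2). Since [l2norm] is +oo off
   l2, a finite [opnorm] forces [T] to map l2 into l2. *)
Definition bounded_on_l2 T : Prop :=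
  (forall (a : Cplx R) u v, l2 u -> l2 v -> T (a *: u + v) = a *: T u + T v) /\
  (opnorm T < +oo)%E.

Definition delta_seq (r : int) A : Seq R L := fun n => if n == r then A else 0.

Definition op_kernel T (s r : int) A : Mat R L := T (delta_seq r A) s.

(* Sum over all integers; the order of summation is immaterial as it is only
   used on absolutely summable families. [Negz k] is -(k + 1). *)
Definition zsum (f : Seq R L) : Mat R L :=
  limn (series (fun k => f (Posz k))) + limn (series (fun k => f (Negz k))).

(* Acts on all sequences, since it is also applied outside l2. *)
Definition weight_op (alpha : R) u : Seq R L :=
  fun n => (((1 + `|n|%N%:R) `^ (- alpha))%:C : Cplx R) *: u n.

(* K is a set of spectral parameters, F a B(l2)-valued function on K. *)
Definition hoelder_on (K : set (Cplx R)) (beta : R)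
    (F : Cplx R -> Seq R L -> Seq R L) : Prop :=
  exists c : R, forall E E' : Cplx R, K E -> K E' ->
    (opnorm (fun u => F E u - F E' u)%R
       <= (c * ComplexField.Normc.normc (E - E') `^ beta)%R%:E)%E.

End MatrixSequences.

Section Schroedinger.
Context {R : realType} {L : nat}.
Variable V : Seq R L.
Implicit Types (E : Cplx R) (u v : Seq R L) (A : Mat R L).

Definition weighted_norm (rho : R) : \bar R :=
  \esum_(n in [set: int]) ((1 + `|n|%N%:R) `^ rho * mat_norm (V n))%:E.

Definition tau u : Seq R L := fun n => u (n + 1) + u (n - 1) + V n *m u n.

Definition point_spectrum : set (Cplx R) :=
  [set E | exists u, [/\ l2 u, u != 0 & tau u = E *: u]].

(* (H - E)^-1, where H is tau restricted to l2; the default value 0 plays no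
   role for E in the resolvent set. *)
Definition resolvent E u : Seq R L :=
  xget 0 [set v | l2 v /\ tau v - E *: v = u].

(* In the sequel [b : bool] is the choice of sign: false is +, true is -. *)
Definition half_plane (b : bool) : set (Cplx R) :=
  [set E | 0 < (-1) ^+ b * complex.Im E].

(* As M_L is finite-dimensional, the pointwise limit in A is the limit in
   B(M_L). The limits exist as soon as V is self-adjoint with a finite
   [weighted_norm] of positive order, so [lim] takes no default value there. *)
Definition bv_kernel (b : bool) E (s r : int) A : Mat R L :=
  if -2 < E < 2
  then lim (op_kernel (resolvent (E + (0 +i* ((-1) ^+ b * e)))) s r A
              @[e --> (0 : R)^'+])
  else op_kernel (resolvent E) s r A.

Definition bv_resolvent_dom (b : bool) E : set (Seq R L) :=
  [set u | forall s : int,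
     summable [set: int] (fun r => (mat_norm (bv_kernel b E s r (u r)))%:E)].

Definition bv_resolvent (b : bool) E u : Seq R L :=
  fun s => zsum (fun r => bv_kernel b E s r (u r)).

Definition weighted_bv_resolvent (b : bool) (alpha : R) E u : Seq R L :=
  weight_op alpha (bv_resolvent b E (weight_op alpha u)).

End Schroedinger.

(* Main.v *)
(* For E = z + 1/z with |z| <= 1, on the chosen side of the cut, the free equation
   has the fundamental solution g_z(n) = z^|n| / (z - 1/z), and the kernel of the
   resolvent applied to delta_r A is the bounded solution v of
   v = g_z * (delta_r A - V v); this formulation makes sense up to the boundary
   |z| = 1.  Bounded solutions of v = - g_z * (V v) vanish: for |z| < 1 they are
   eigenfunctions, and for |z| = 1 conservation of the current
   Im tr(v(n)^* v(n+1)) together with the outgoing form of v at both ends forces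
   v -> 0 at +oo, after which a tail contraction gives v = 0.  A compactness
   argument along an ultrafilter upgrades uniqueness to the a priori bound
   sup |v| <= C sum |f| for v = g_z * (f - W v), uniformly for E in K and for
   W = V or a far truncation of V; existence follows from finite-dimensional
   linear algebra for the truncations.  For two parameters the difference of the
   solutions splits as h + w', where h = (g_z - g_z') * (delta_r A - V v') is
   O(|E - E'|^beta (1+|n|)^beta (1+|r|)^beta) and w' solves the same equation
   with the summable source - V h, so the kernel is Hoelder with these weights,
   and (1+|n|)^(beta - alpha) is square summable. *)

Require Import Defs.
From HB Require Import structures.
From mathcomp Require Import all_boot all_order all_algebra.
From mathcomp Require Import all_classical all_reals all_analysis.
From mathcomp Require Import complex.
From mathcomp Require Import zify ring lra.

Set Implicit Arguments.
Unset Strict Implicit.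
Unset Printing Implicit Defensive.

Import Order.TTheory GRing.Theory Num.Theory.
Import numFieldNormedType.Exports.

Local Open Scope classical_set_scope.
Local Open Scope complex_scope.
Local Open Scope ring_scope.

(** The class of potentials in the a priori bound is dictated by existence. A truncation of [V] may
    have an eigenvalue at the given E, so injectivity of its finite linear system cannot be read off
    from the assumption on [V]; the bound with zero source supplies it. Compactness yields only
    pointwise convergence of the normalized violators to zero. With |V| as majorant, dominated
    convergence makes the products W v small in l1, and one application of the bounded kernel g_z
    makes v small in sup norm, against the normalization. The exponent comes from |z^m - z'^m| <=
    min(2, m |z - z'|), interpolated to 2 (m |z - z'|)^beta with beta = min(rho, 1): the growth in
    |n - k| splits into a factor in n, left to the weight T, and a factor in k, absorbed by V
    because beta <= rho, or by T at the point source. The boundary values of the kernel are defined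
    as limits of a resolvent; they are identified by applying the same Hoelder estimate to the
    compact segment from E to E + i or E - i, whose nonreal points are never eigenvalues. *)

Lemma ultra_compact_cvg {T : Type} {X : topologicalType} {F : set_system T}
    {FF : UltraFilter F} (s : T -> X) (K : set X) :
  compact K -> (forall t, K (s t)) -> exists2 p, K p & s @ F --> p.
Proof.
move=> cK Ks; have FK : F (s @^-1` K) by apply: filterS filterT => t _; exact: Ks.
have [p [Kp clp]] := cK (s @ F) _ FK.
exists p => // U pU; have [//|h] := in_ultra_setVsetC (s @^-1` U) FF.
have [x [h1 h2]] : (~` U) `&` U !=set0 by exact: clp h pU.
by case: h1.
Qed.

(** * Sums over the integers *)

Section PartialSums.

(* The window of size [N] is [-N, N - 1], since [Negz k] is -(k + 1). *)
Definition psum {V : zmodType} (f : int -> V) (N : nat) : V :=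
  \sum_(0 <= k < N) (f (Posz k) + f (Negz k)).

Definition in_window (N : nat) (n : int) : bool :=
  match n with Posz k => (k < N)%N | Negz k => (k < N)%N end.

Lemma in_window_ex (n : int) : exists N, in_window N n.
Proof. by case: n => k; exists k.+1; rewrite /= ltnS. Qed.

Lemma in_windowW (N N' : nat) (n : int) :
  (N <= N')%N -> in_window N n -> in_window N' n.
Proof. by case: n => k /= NN' /leq_trans; apply. Qed.

Section Zmod.
Variable V : zmodType.
Implicit Types f g : int -> V.

Lemma psum0 f : psum f 0 = 0.
Proof. by rewrite /psum big_nil. Qed.

Lemma psumS f N : psum f N.+1 = psum f N + (f (Posz N) + f (Negz N)).
Proof. by rewrite /psum big_nat_recr. Qed.

Lemma psumD f g N : psum (fun n => f n + g n) N = psum f N + psum g N.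
Proof. by rewrite /psum -big_split /=; apply: eq_bigr => k _; rewrite addrACA. Qed.

Lemma psumN f N : psum (fun n => - f n) N = - psum f N.
Proof. by rewrite /psum -sumrN; apply: eq_bigr => k _; rewrite opprD. Qed.

Lemma psumB f g N : psum (fun n => f n - g n) N = psum f N - psum g N.
Proof. by rewrite psumD psumN. Qed.

Lemma eq_psum f g N : (forall n, in_window N n -> f n = g n) ->
  psum f N = psum g N.
Proof. by move=> fg; apply: eq_big_nat => k /andP[_ kN]; rewrite !fg. Qed.

Lemma psum_stable f N N' : (forall n, ~~ in_window N n -> f n = 0) ->
  (N <= N')%N -> psum f N' = psum f N.
Proof.
move=> f0; elim: N' => [|N' IH]; first by rewrite leqn0 => /eqP ->.
rewrite leq_eqVlt => /predU1P[->//|]; rewrite ltnS => NN'.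
by rewrite psumS !f0 ?IH ?addr0 //= -leqNgt.
Qed.

Lemma psum_windowE f N :
  psum f N = \sum_(p : bool * 'I_N) f (if p.1 then Posz p.2 else Negz p.2).
Proof.
rewrite -(pair_bigA _ (fun (b : bool) (k : 'I_N) =>
  f (if b then Posz k else Negz k))) /= big_bool /= -big_split /=.
by rewrite /psum big_mkord.
Qed.

End Zmod.

Lemma raddf_psum {V W : zmodType} (h : {additive V -> W}) (f : int -> V) N :
  h (psum f N) = psum (h \o f) N.
Proof. by rewrite /psum raddf_sum; apply: eq_bigr => k _; rewrite raddfD. Qed.

End PartialSums.

Section RealSums.
Context {R : realType}.
Implicit Types (a b q : int -> R) (M : R).

(** For a nonnegative family this says that the whole sum is at most [M]. Carrying a majorant
    instead of the value of the sum keeps the estimates free of limits. *)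
Definition bsum a M := forall N, psum a N <= M.

Lemma ler_psum a b N : (forall n, a n <= b n) -> psum a N <= psum b N.
Proof. by move=> ab; apply: ler_sum => k _; rewrite lerD. Qed.

Lemma psum_ge0 a N : (forall n, 0 <= a n) -> 0 <= psum a N.
Proof. by move=> a0; apply: sumr_ge0 => k _; rewrite addr_ge0. Qed.

Lemma psum_homo a N N' : (forall n, 0 <= a n) -> (N <= N')%N ->
  psum a N <= psum a N'.
Proof.
move=> a0; elim: N' => [|N' IH]; first by rewrite leqn0 => /eqP ->.
rewrite leq_eqVlt => /predU1P[->//|]; rewrite ltnS => /IH /le_trans; apply.
by rewrite psumS lerDl addr_ge0.
Qed.

Lemma psumMl c a N : psum (fun n => c * a n) N = c * psum a N.
Proof. by rewrite /psum mulr_sumr; apply: eq_bigr => k _; rewrite mulrDr. Qed.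

Lemma psum_ge_term a n N : (forall n, 0 <= a n) -> in_window N n ->
  a n <= psum a N.
Proof.
move=> a0; elim: N => [|N IH]; first by case: n.
have [nN _|nN nSN] := boolP (in_window N n).
  by apply: le_trans (IH nN) _; apply: psum_homo.
rewrite psumS; apply: (@le_trans _ _ (a (Posz N) + a (Negz N))); last first.
  by rewrite lerDr psum_ge0.
by case: n nN nSN {IH} => k /=; rewrite ltnS -leqNgt => h2 h1;
  have -> : k = N by [apply/eqP; rewrite eqn_leq h1 h2]; rewrite ?lerDl ?lerDr.
Qed.

Lemma bsum_ge0 a M : bsum a M -> 0 <= M.
Proof. by move=> /(_ 0%N); rewrite psum0. Qed.

Lemma ler_bsum a b M : (forall n, a n <= b n) -> bsum b M -> bsum a M.
Proof. by move=> ab bM N; exact: le_trans (ler_psum N ab) (bM N). Qed.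

Lemma bsumD a b M M' : bsum a M -> bsum b M' -> bsum (fun n => a n + b n) (M + M').
Proof. by move=> aM bM N; rewrite psumD lerD. Qed.

Lemma bsumMl c a M : 0 <= c -> bsum a M -> bsum (fun n => c * a n) (c * M).
Proof. by move=> c0 aM N; rewrite psumMl ler_wpM2l. Qed.

Lemma bsum_tail a M e : (forall n, 0 <= a n) -> bsum a M -> 0 < e ->
  exists N, forall N', psum a N' - psum a N <= e.
Proof.
move=> a0 aM e0; have hs : has_sup (range (psum a)).
  by split; [exists (psum a 0%N), 0%N|exists M => _ [N _ <-]].
have [_ [N _ <-] hN] := sup_adherent e0 hs; exists N => N'.
have : psum a N' <= sup (range (psum a)) by apply: sup_upper_bound hs _ _; exists N'.
by lra.
Qed.

Lemma cvg0D {T : Type} {F : set_system T} {FF : Filter F} (f g : T -> R) :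
  f @ F --> 0 -> g @ F --> 0 -> f t + g t @[t --> F] --> 0.
Proof. by move=> f0 g0; rewrite -(addr0 0); exact: cvgD. Qed.

Lemma cvg0M {T : Type} {F : set_system T} {FF : Filter F} (f : T -> R) (c : R) :
  f @ F --> 0 -> f t * c @[t --> F] --> 0.
Proof. by move=> f0; rewrite -(mul0r c); exact: cvgMl. Qed.

Lemma cvg0_le {T : Type} {F : set_system T} {FF : Filter F} (f g : T -> R) :
  (\forall t \near F, 0 <= f t <= g t) -> g @ F --> 0 -> f @ F --> 0.
Proof. by move=> fg; exact: (squeeze_cvgr fg (cvg_cst 0)). Qed.

Lemma cvg_psum0 {T : Type} {F : set_system T} {FF : Filter F} (a : T -> int -> R) N :
  (forall n, a t n @[t --> F] --> 0) -> psum (a t) N @[t --> F] --> 0.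
Proof.
move=> a0; elim: N => [|N IH].
  by under eq_fun do rewrite psum0; exact: cvg_cst.
under eq_fun do rewrite psumS.
by apply: cvg0D => //; exact: cvg0D.
Qed.

(** Dominated convergence along an arbitrary filter: half of [e] is spent on the tail of [q] beyond
    a fixed window, half on the finitely many terms inside it. *)
Lemma dominated_bsum {T : Type} {F : set_system T} {FF : ProperFilter F}
    (a : T -> int -> R) q M :
  (forall t n, 0 <= a t n) -> (forall t n, a t n <= q n) -> bsum q M ->
  (forall n, a t n @[t --> F] --> 0) ->
  forall e, 0 < e -> \forall t \near F, bsum (a t) e.
Proof.
move=> a0 aq qM cv e e0; have e20 : 0 < e / 2 by rewrite divr_gt0.
have q0 n : 0 <= q n by have [t _] := filter_ex (filterT : F setT); apply: le_trans (aq t n).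
have [N hN] := bsum_tail q0 qM e20.
near=> t => N'.
have h : `|psum (a t) N| < e / 2.
  by near: t; apply: cvgr0_norm_lt => //; exact: cvg_psum0.
have [N'N|/ltnW NN'] := leqP N' N.
  have := psum_homo (a0 t) N'N; have := ler_norm (psum (a t) N); lra.
have : psum (a t) N' - psum (a t) N <= psum q N' - psum q N.
  elim: N' NN' => [|m IH]; first by rewrite leqn0 => /eqP ->; lra.
  rewrite leq_eqVlt => /predU1P[->|]; first lra.
  rewrite ltnS => /IH; rewrite !psumS; have := aq t (Posz m).
  have := aq t (Negz m); lra.
by have := hN N'; have := ler_norm (psum (a t) N); lra.
Unshelve. all: by end_near. Qed.

End RealSums.

(** * Comparison of window sums with extended-real sums *)

Section Esum.
Context {R : realType}.
Implicit Types (a : int -> R) (M : R).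

Definition window_seq (N : nat) : seq int :=
  map Posz (iota 0 N) ++ map Negz (iota 0 N).

Lemma mem_window_seq N n : (n \in window_seq N) = in_window N n.
Proof.
rewrite mem_cat; apply/orP/idP => [[|]/mapP[k]|].
- by rewrite mem_iota => /andP[_ kN] ->.
- by rewrite mem_iota => /andP[_ kN] ->.
by case: n => k kN; [left|right]; apply/mapP; exists k; rewrite ?mem_iota.
Qed.

Lemma window_seq_uniq N : uniq (window_seq N).
Proof.
rewrite cat_uniq !map_inj_uniq ?iota_uniq //= ?andbT; last by move=> ? ? [].
  by apply/hasPn => n /mapP[k _ ->]; apply/negP => /mapP[].
by move=> ? ? [].
Qed.

Lemma big_window_seq a N : \sum_(n <- window_seq N) a n = psum a N.
Proof.
by rewrite big_cat !big_map /psum /index_iota subn0 big_split.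
Qed.

(** Every finite set of integers lies in a window, so windows are cofinal among the finite sets that
    define the sum. *)
Lemma esum_le_bsum a M : (forall n, 0 <= a n) ->
  ((\esum_(n in [set: int]) (a n)%:E <= M%:E)%E <-> bsum a M).
Proof.
move=> a0; have fsum N : \sum_(n \in [set` window_seq N]) (a n)%:E = (psum a N)%:E.
  by rewrite -fsbig_seq ?window_seq_uniq // sumEFin big_window_seq.
split=> [h N|h].
  rewrite -lee_fin; apply: le_trans h; apply: esum_ge.
  by exists [set` window_seq N]; [split=> //; exact: finite_seq|rewrite fsum].
apply: ge_ereal_sup => _ [X [finX _] <-].
have [N XN] : exists N, X `<=` [set` window_seq N].
  have /finite_seqP[s Xs] := finX; rewrite Xs => {finX Xs X}.
  elim: s => [|n s [N IH]]; first by exists 0%N.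
  have [N' nN'] := in_window_ex n; exists (maxn N N') => m /=.
  rewrite mem_window_seq inE => /predU1P[->|ms].
    exact: in_windowW (leq_maxr _ _) nN'.
  have /= := IH m ms; rewrite mem_window_seq.
  exact/in_windowW/leq_maxl.
apply: (@le_trans _ _ (\sum_(n \in [set` window_seq N]) (a n)%:E)%E).
  apply: lee_fsum_nneg_subset => //; first exact: finite_seq.
    exact/subsetP.
  by move=> t _; rewrite lee_fin.
by rewrite fsum lee_fin.
Qed.

Lemma esum_lty_bsum a : (forall n, 0 <= a n) ->
  (\esum_(n in [set: int]) (a n)%:E < +oo)%E -> exists M, bsum a M.
Proof.
move=> a0; have : (0 <= \esum_(n in [set: int]) (a n)%:E)%E.
  by apply: esum_ge0 => n _; rewrite lee_fin.
case E : (esum _ _) => [M| |] // _ _.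
by exists M; apply/esum_le_bsum => //; rewrite E.
Qed.

End Esum.

(** * Translations, geometric series and p-series over the integers *)

Section ConcreteSums.
Context {R : realType}.
Implicit Types (a : int -> R) (M : R).

Lemma bsum_succ a M : (forall n, 0 <= a n) -> bsum a M ->
  bsum (fun n => a (n + 1)) M.
Proof.
move=> a0 aM N.
(* Shifting trades the left end of the window for one new right end, so the shifted sum is at most
   the sum over the next larger window. *)
have E : psum (fun n => a (n + 1)) N.+1 + a (Negz N) = psum a N.+1 + a (Posz N.+1).
  elim: N => [|N IH].
    by rewrite !psumS !psum0 !(add0r (_ + _)) -[Posz 0 + 1]/(Posz 1) -[Negz 0 + 1]/(Posz 0); lra.
  rewrite [in RHS]psumS (psumS (fun n => a (n + 1))).
  have -> : (Negz N.+1 + 1 = Negz N)%R by lia.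
  rewrite -[Posz N.+1 + 1]/(Posz (N.+1 + 1)) addn1; lra.
have := psum_homo (fun n => a0 (n + 1)) (leqnSn N).
by have := aM N.+2; rewrite psumS; have := a0 (Negz N); have := a0 (Negz N.+1); lra.
Qed.

Lemma bsum_pred a M : (forall n, 0 <= a n) -> bsum a M ->
  bsum (fun n => a (n - 1)) M.
Proof.
move=> a0 aM N.
have E : psum (fun n => a (n - 1)) N.+1 + a (Posz N) = psum a N.+1 + a (Negz N.+1).
  elim: N => [|N IH].
    by rewrite !psumS !psum0 !(add0r (_ + _)) -[Posz 0 - 1]/(Negz 0) -[Negz 0 - 1]/(Negz 1); lra.
  rewrite [in RHS]psumS (psumS (fun n => a (n - 1))).
  have -> : (Posz N.+1 - 1 = Posz N)%R by lia.
  have -> : (Negz N.+1 - 1 = Negz N.+2)%R by lia.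
  lra.
have := psum_homo (fun n => a0 (n - 1)) (leqnSn N).
by have := aM N.+2; rewrite psumS; have := a0 (Posz N); have := a0 (Posz N.+1); lra.
Qed.

Lemma bsum_shift a M (k : int) : (forall n, 0 <= a n) -> bsum a M ->
  bsum (fun n => a (n + k)) M.
Proof.
move=> a0 aM; elim: k => [|m IH|m IH].
- by under eq_fun do rewrite addr0.
- apply: ler_bsum (bsum_succ _ IH) => // n.
  by have -> : (n + m.+1 = n + 1 + m)%R by lia.
- apply: ler_bsum (bsum_pred _ IH) => // n.
  by have -> : (n - m.+1%:Z = n - 1 - m%:Z)%R by lia.
Qed.

Lemma bsum_geometric (x : R) : 0 <= x < 1 ->
  bsum (fun n : int => x ^+ `|n|) (2 / (1 - x)).
Proof.
move=> /andP[x0 x1] N.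
(* The exact value is (1 + x - x^N - x^(N+1)) / (1 - x); keeping the subtracted powers makes the
   induction close. *)
have h : psum (fun n : int => x ^+ `|n|) N <= (2 - x ^+ N - x ^+ N.+1) / (1 - x).
  have x1' : 1 - x != 0 by lra.
  elim: N => [|N IH]; first by rewrite psum0 expr0 expr1 divr_ge0; lra.
  rewrite psumS /=; apply: le_trans (lerD IH (lexx _)) _.
  rewrite -[X in _ + X](mulfK x1') -mulrDl ler_pM2r ?invr_gt0; last lra.
  by rewrite !exprS; nra.
apply: le_trans h _; rewrite ler_pM2r ?invr_gt0; last lra.
by have := exprn_ge0 N x0; have := exprn_ge0 N.+1 x0; lra.
Qed.

(* With [p = 1 + q], this bounds the terms of the p-series by differences; it comes
   from [- ln (1 - 1 / (1 + x)) >= 1 / (1 + x)]. *)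
Lemma powR_telescope (q x : R) : 0 < q -> 1 <= x ->
  q * (1 + x) `^ (- (1 + q)) <= x `^ (- q) - (1 + x) `^ (- q).
Proof.
move=> q0 x1; have x0 : 0 < x by lra. have x10 : 0 < 1 + x by lra.
rewrite opprD powRD; last by rewrite (gt_eqF x10) implybT.
rewrite powR_inv1 ?(ltW x10) //.
suff : x `^ (- q) >= (1 + x) `^ (- q) * (1 + q / (1 + x)).
  rewrite mulrDr mulr1; lra.
rewrite -[x in leRHS](mulfK (lt0r_neq0 x10)) mulrAC.
rewrite powRM ?divr_ge0 ?(ltW x10) ?(ltW x0) // mulrC.
rewrite ler_wpM2r ?powR_ge0 //.
have y0 : 0 < x / (1 + x) by rewrite divr_gt0.
rewrite /powR (gt_eqF y0); apply: le_trans (expR_ge1Dx _).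
rewrite lerD2l // mulNr -mulrN ler_pM2l //.
have yE : x / (1 + x) = 1 + - (1 + x)^-1 by field; rewrite lt0r_neq0.
rewrite yE lerNr; apply: le_ln1Dx; rewrite -subr_gt0 opprK addrC -yE //.
Qed.

Lemma bsum_powR (p : R) : 1 < p ->
  exists M, bsum (fun n : int => (1 + `|n|%N%:R) `^ (- p)) M.
Proof.
move=> p1; pose q := p - 1; have q0 : 0 < q by rewrite subr_gt0.
have {p1} -> : p = 1 + q by rewrite /q; lra.
pose u (k : nat) : R := (1 + k%:R) `^ (- (1 + q)).
pose t (k : nat) : R := q^-1 * (1 + k%:R) `^ (- q).
have ut k : u k.+1 + t k.+1 <= t k.
  have := @powR_telescope q (1 + k%:R) q0; rewrite lerDl ler0n => /(_ isT).
  have -> : 1 + (1 + k%:R) = 1 + k.+1%:R :> R by rewrite -natr1; lra.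
  by rewrite -ler_pdivlMl // mulrBr /u /t; lra.
have t0 k : 0 <= t k by rewrite mulr_ge0 ?powR_ge0 // invr_ge0 ltW.
(* [t N] and [t N.+1] dominate the terms still missing on the right and on the left; they differ
   because the window reaches one step further to the left. The 1 is the term at 0. *)
suff h N : psum (fun n : int => (1 + `|n|%N%:R) `^ (- (1 + q))) N.+1 +
    (t N + t N.+1) <= 1 + (t 0%N + t 0%N).
  exists (1 + (t 0%N + t 0%N)) => N; apply: le_trans (psum_homo _ (leqnSn _)) _.
    by move=> n; exact: powR_ge0.
  by have := h N; have := t0 N; have := t0 N.+1; lra.
elim: N => [|N IH].
  rewrite psumS psum0 add0r /= addr0 powR1 -/(u 1%N); have := ut 0%N; lra.
rewrite psumS /= -/(u N.+1) -/(u N.+2); have := ut N; have := ut N.+1; lra.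
Qed.

End ConcreteSums.

Local Notation cnorm := ComplexField.Normc.normc.

(** * Norms and limits of matrices *)

Section ComplexNorm.
Context {R : realType}.
Implicit Types (x y z : Cplx R).

Lemma normr_cnormE x : `|x| = (cnorm x)%:C.
Proof. by []. Qed.

Lemma cnorm_ge0 x : 0 <= cnorm x.
Proof. by case: x => a b; rewrite /= sqrtr_ge0. Qed.

Lemma cnorm0 : cnorm (0 : Cplx R) = 0.
Proof. exact: ComplexField.Normc.normc0. Qed.

Lemma cnorm1 : cnorm (1 : Cplx R) = 1.
Proof. exact: ComplexField.Normc.normc1. Qed.

Lemma cnormM x y : cnorm (x * y) = cnorm x * cnorm y.
Proof. exact: ComplexField.Normc.normcM. Qed.

Lemma cnormV x : cnorm x^-1 = (cnorm x)^-1.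
Proof. exact: ComplexField.Normc.normcV. Qed.

Lemma cnormN x : cnorm (- x) = cnorm x.
Proof. exact: normcN. Qed.

Lemma ler_cnormD x y : cnorm (x + y) <= cnorm x + cnorm y.
Proof. exact: le_normcD. Qed.

Lemma ler_cnormB x y : cnorm (x - y) <= cnorm x + cnorm y.
Proof. by rewrite -[in leRHS](cnormN y); exact: ler_cnormD. Qed.

Lemma cnormBC x y : cnorm (x - y) = cnorm (y - x).
Proof. by rewrite -cnormN opprB. Qed.

Lemma cnorm_eq0 x : (cnorm x == 0) = (x == 0).
Proof.
by apply/eqP/eqP => [/ComplexField.Normc.eq0_normc //|->]; rewrite cnorm0.
Qed.

Lemma cnorm_gt0 x : (0 < cnorm x) = (x != 0).
Proof. by rewrite lt_def cnorm_ge0 andbT cnorm_eq0. Qed.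

Lemma cnormX x n : cnorm (x ^+ n) = cnorm x ^+ n.
Proof. by elim: n => [|n IH]; rewrite ?expr0 ?cnorm1 // !exprS cnormM IH. Qed.

Lemma cnorm_sqr x : cnorm x ^+ 2 = complex.Re x ^+ 2 + complex.Im x ^+ 2.
Proof. by case: x => a b /=; rewrite sqr_sqrtr // addr_ge0 ?sqr_ge0. Qed.

Lemma cnorm_le_ReIm x : cnorm x <= `|complex.Re x| + `|complex.Im x|.
Proof.
rewrite -(@ler_pXn2r _ 2) ?nnegrE ?cnorm_ge0 ?addr_ge0 //.
rewrite cnorm_sqr sqrrD !real_normK ?num_real // -addrA lerD2l lerDr.
by rewrite mulrn_wge0 ?mulr_ge0.
Qed.

Lemma Re_le_cnorm x : `|complex.Re x| <= cnorm x.
Proof.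
by rewrite -(@ler_pXn2r _ 2) ?nnegrE ?cnorm_ge0 // cnorm_sqr real_normK ?num_real //
  lerDl sqr_ge0.
Qed.

Lemma Im_le_cnorm x : `|complex.Im x| <= cnorm x.
Proof.
by rewrite -(@ler_pXn2r _ 2) ?nnegrE ?cnorm_ge0 // cnorm_sqr real_normK ?num_real //
  lerDr sqr_ge0.
Qed.

(** A positive element of [Cplx R] is a positive real, so the complex-valued radii of the topology
    reduce to real ones. *)
Lemma cvg_cnorm {T : Type} {F : set_system T} {FF : Filter F} (f : T -> Cplx R) x :
  f @ F --> x <-> cnorm (f t - x) @[t --> F] --> 0.
Proof.
split=> [/cvgrPdist_lt h|h].
  apply/cvgr0Pnorm_lt => e e0; have := h e%:C.
  rewrite ltcR => /(_ e0); apply: filterS => t.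
  by rewrite normr_cnormE ltcR cnormBC ger0_norm ?cnorm_ge0.
apply/cvgrPdist_lt => e; case: e => a b; rewrite ltcE /= => /andP[/eqP -> a0].
move/cvgr0Pnorm_lt: h => /(_ a a0); apply: filterS => t.
rewrite ger0_norm ?cnorm_ge0 // cnormBC => h.
by rewrite normr_cnormE -[(a +i* 0)%C]/(a%:C) ltcR.
Qed.

End ComplexNorm.

Section MatrixNorm.
Context {R : realType} {L : nat}.
Implicit Types (A B : Mat R L) (f g : Seq R L).

(* The entrywise l1 norm: submultiplicative, and equivalent to [mat_norm]. *)
Definition nrm A : R := \sum_i \sum_j cnorm (A i j).

Lemma nrm_ge0 A : 0 <= nrm A.
Proof. by apply: sumr_ge0 => i _; apply: sumr_ge0 => j _; exact: cnorm_ge0. Qed.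

Lemma cnorm_le_nrm A i j : cnorm (A i j) <= nrm A.
Proof.
rewrite /nrm (bigD1 i) //= (bigD1 j) //= -addrA lerDl.
by rewrite addr_ge0 // sumr_ge0 // => k _; rewrite ?cnorm_ge0 // sumr_ge0 // => l _;
  rewrite cnorm_ge0.
Qed.

Lemma nrm0 : nrm 0 = 0.
Proof. by apply: big1 => i _; apply: big1 => j _; rewrite mxE cnorm0. Qed.

Lemma nrm_eq0 A : nrm A = 0 -> A = 0.
Proof.
move=> A0; apply/matrixP => i j; rewrite mxE; apply/eqP.
by rewrite -cnorm_eq0 eq_le cnorm_ge0 andbT -A0 cnorm_le_nrm.
Qed.

Lemma ler_nrmD A B : nrm (A + B) <= nrm A + nrm B.
Proof.
rewrite /nrm -big_split /=; apply: ler_sum => i _.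
by rewrite -big_split /=; apply: ler_sum => j _; rewrite mxE; exact: ler_cnormD.
Qed.

Lemma nrmN A : nrm (- A) = nrm A.
Proof.
by apply: eq_bigr => i _; apply: eq_bigr => j _; rewrite mxE cnormN.
Qed.

Lemma ler_nrmB A B : nrm (A - B) <= nrm A + nrm B.
Proof. by rewrite -[in leRHS](nrmN B); exact: ler_nrmD. Qed.

Lemma nrmBC A B : nrm (A - B) = nrm (B - A).
Proof. by rewrite -nrmN opprB. Qed.

Lemma nrmZ (a : Cplx R) A : nrm (a *: A) = cnorm a * nrm A.
Proof.
rewrite /nrm mulr_sumr; apply: eq_bigr => i _; rewrite mulr_sumr.
by apply: eq_bigr => j _; rewrite mxE cnormM.
Qed.

Lemma ler_cnorm_sum (I : Type) (r : seq I) (P : pred I) (F : I -> Cplx R) :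
  cnorm (\sum_(i <- r | P i) F i) <= \sum_(i <- r | P i) cnorm (F i).
Proof.
elim/big_ind2: _ => [|x1 x2 y1 y2 h1 h2|//]; first by rewrite cnorm0.
by apply: le_trans (ler_cnormD _ _) _; exact: lerD.
Qed.

Lemma ler_nrm_sum (I : Type) (r : seq I) (P : pred I) (F : I -> Mat R L) :
  nrm (\sum_(i <- r | P i) F i) <= \sum_(i <- r | P i) nrm (F i).
Proof.
elim/big_ind2: _ => [|x1 x2 y1 y2 h1 h2|//]; first by rewrite nrm0.
by apply: le_trans (ler_nrmD _ _) _; exact: lerD.
Qed.

Lemma ler_nrmM A B : nrm (A *m B) <= nrm A * nrm B.
Proof.
apply: (@le_trans _ _ (\sum_i \sum_j \sum_k cnorm (A i k) * cnorm (B k j))).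
  apply: ler_sum => i _; apply: ler_sum => j _; rewrite mxE.
  apply: le_trans (ler_cnorm_sum _ _ _) _.
  by apply: ler_sum => k _; rewrite cnormM.
rewrite /nrm mulr_suml; apply: ler_sum => i _; rewrite mulr_suml exchange_big /=.
apply: ler_sum => k _; rewrite -mulr_sumr ler_wpM2l ?cnorm_ge0 //.
rewrite [leRHS](bigD1 k) //= lerDl sumr_ge0 // => l _.
by apply: sumr_ge0 => j _; exact: cnorm_ge0.
Qed.

Lemma Re_mat_dot A : complex.Re (mat_dot A A) = \sum_i \sum_j cnorm (A i j) ^+ 2.
Proof.
rewrite /mat_dot /mxtrace raddf_sum exchange_big /=; apply: eq_bigr => j _.
rewrite mxE raddf_sum; apply: eq_bigr => i _; rewrite !mxE cnorm_sqr.
by case: (A i j) => a b; rewrite /= !expr2 mulNr opprK.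
Qed.

Lemma mat_norm_ge0 A : 0 <= mat_norm A.
Proof. exact: sqrtr_ge0. Qed.

Lemma mat_norm_le_nrm A : mat_norm A <= nrm A.
Proof.
rewrite /mat_norm -[leRHS]ger0_norm ?nrm_ge0 // -sqrtr_sqr; apply: ler_wsqrtr.
rewrite Re_mat_dot expr2 {1}/nrm mulr_suml; apply: ler_sum => i _.
rewrite mulr_suml; apply: ler_sum => j _.
by rewrite expr2 ler_wpM2l ?cnorm_ge0 ?cnorm_le_nrm.
Qed.

Lemma cnorm_le_mat_norm A i j : cnorm (A i j) <= mat_norm A.
Proof.
rewrite /mat_norm -[leLHS]ger0_norm ?cnorm_ge0 // -sqrtr_sqr; apply: ler_wsqrtr.
rewrite Re_mat_dot (bigD1 i) //= (bigD1 j) //= -addrA lerDl.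
by rewrite addr_ge0 // sumr_ge0 // => k _; rewrite ?sqr_ge0 // sumr_ge0 // => l _;
  rewrite sqr_ge0.
Qed.

Lemma nrm_le_mat_norm A : nrm A <= (L ^ 2)%:R * mat_norm A.
Proof.
apply: (@le_trans _ _ (\sum_(i < L) \sum_(j < L) mat_norm A)).
  by apply: ler_sum => i _; apply: ler_sum => j _; exact: cnorm_le_mat_norm.
by rewrite !sumr_const !card_ord -mulrnA -[leLHS]mulr_natl.
Qed.

Lemma nrm_cvg {T : Type} {F : set_system T} {FF : Filter F} (f : T -> Mat R L) A :
  nrm (f t - A) @[t --> F] --> 0 -> f @ F --> A.
Proof.
move=> h; apply/cvg_ballP => -[a b]; rewrite ltcE /= => /andP[/eqP -> a0].
move/cvgr0Pnorm_lt: h => /(_ a a0); apply: filterS => t.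
rewrite ger0_norm ?nrm_ge0 // nrmBC => h; split => [|i j].
  by rewrite -[(a +i* 0)%C]/(a%:C) ltcR.
rewrite /ball /= -[(a +i* 0)%C]/(a%:C) normr_cnormE ltcR; apply: le_lt_trans h.
by apply: le_trans (cnorm_le_nrm _ i j); rewrite !mxE.
Qed.

Lemma nrm_cvg_entries {T : Type} {F : set_system T} {FF : Filter F}
    (f : T -> Mat R L) A :
  (forall i j, complex.Re (f t i j) @[t --> F] --> complex.Re (A i j)) ->
  (forall i j, complex.Im (f t i j) @[t --> F] --> complex.Im (A i j)) ->
  nrm (f t - A) @[t --> F] --> 0.
Proof.
move=> hR hI; apply: (@squeeze_cvgr _ _ _ _ (fun=> 0) (fun t => \sum_i \sum_j
  (`|complex.Re (f t i j) - complex.Re (A i j)| +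
   `|complex.Im (f t i j) - complex.Im (A i j)|))).
- apply: nearW => t; rewrite nrm_ge0 /=; apply: ler_sum => i _.
  apply: ler_sum => j _; rewrite !mxE; apply: le_trans (cnorm_le_ReIm _) _.
  by rewrite !raddfB.
- exact: cvg_cst.
have z (s : T -> R) l : s @ F --> l -> `|s t - l| @[t --> F] --> 0.
  move=> sl; rewrite -(@normr0 _ R); apply: cvg_norm.
  by rewrite -(subrr l); apply: cvgB => //; exact: cvg_cst.
have s0 (I : finType) (s : I -> T -> R) : (forall i, s i @ F --> 0) ->
    \sum_i s i t @[t --> F] --> 0.
  move=> sl; elim: (index_enum I) => [|i r IH].
    by under eq_fun do rewrite big_nil; exact: cvg_cst.
  under eq_fun do rewrite big_cons.
  exact: cvg0D.
by apply: (s0) => i; apply: s0 => j; apply: cvg0D; exact: z.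
Qed.

Lemma nrm_lim_unique {T : Type} {F : set_system T} {FF : ProperFilter F}
    (f : T -> Mat R L) A B :
  nrm (f t - A) @[t --> F] --> 0 -> nrm (f t - B) @[t --> F] --> 0 -> A = B.
Proof.
move=> fA fB; apply/eqP; rewrite -subr_eq0; apply/eqP/nrm_eq0/eqP.
rewrite eq_le nrm_ge0 andbT; 
have h : nrm (f t - A) + nrm (f t - B) @[t --> F] --> 0 by exact: cvg0D.
apply: (cvgr_to_ge h).
apply: nearW => t; rewrite (nrmBC (f t) A); apply: le_trans (ler_nrmD _ _).
by rewrite addrA subrK.
Qed.

Lemma nrm_cvg_lim {T : Type} {F : set_system T} {FF : ProperFilter F}
    (f : T -> Mat R L) A :
  nrm (f t - A) @[t --> F] --> 0 -> lim (f t @[t --> F]) = A.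
Proof.
by move=> /nrm_cvg h; apply: cvg_lim => //; exact: norm_hausdorff.
Qed.

(** Used in place of diagonal extraction: a single ultrafilter makes the values at all sites
    converge at once. *)
Lemma ultra_nrm_lim {T : Type} {F : set_system T} {FF : UltraFilter F}
    (f : T -> Mat R L) (M : R) :
  (forall t, nrm (f t) <= M) -> exists A, nrm (f t - A) @[t --> F] --> 0.
Proof.
move=> fM; have cv (s : T -> R) : (forall t, `|s t| <= M) -> exists l : R, s @ F --> l.
  move=> sM; have [|l _ ?] := @ultra_compact_cvg _ _ F _ s _ (@segment_compact R (- M) M).
    by move=> t; rewrite /= in_itv /= -ler_norml.
  by exists l.
have {}cv i j : exists l : Cplx R, complex.Re (f t i j) @[t --> F] --> complex.Re l /\
    complex.Im (f t i j) @[t --> F] --> complex.Im l.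
  have le t := le_trans (cnorm_le_nrm (f t) i j) (fM t).
  have [a ha] := cv _ (fun t => le_trans (Re_le_cnorm _) (le t)).
  have [b hb] := cv _ (fun t => le_trans (Im_le_cnorm _) (le t)).
  by exists (a +i* b).
pose A : Mat R L := \matrix_(i, j) projT1 (cid (cv i j)).
exists A; apply: nrm_cvg_entries => i j; rewrite /A mxE;
  by case: (cid _) => l [].
Qed.

End MatrixNorm.

Section IntegerSums.
Context {R : realType} {L : nat}.
Implicit Types (A B : Mat R L) (f g : Seq R L) (M : R) (q : int -> R).

Lemma nrm_psum f N : nrm (psum f N) <= psum (fun n => nrm (f n)) N.
Proof.
apply: le_trans (ler_nrm_sum _ _ _) _; apply: ler_sum => k _; exact: ler_nrmD.
Qed.

Lemma cvg_abs_series (u : nat -> Mat R L) M :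
  (forall N, \sum_(0 <= k < N) nrm (u k) <= M) ->
  exists S, nrm (series u N - S) @[N --> \oo] --> 0.
Proof.
move=> uM; have cv (s : nat -> R) : (forall k, `|s k| <= nrm (u k)) ->
    exists l : R, series s @ \oo --> l.
  move=> su; exists (lim (series s @ \oo)); apply: normed_cvg.
  apply: nondecreasing_is_cvgn.
    by apply: nondecreasing_series => n _ _; exact: normr_ge0.
  exists M => _ [N _ <-]; by apply: le_trans (uM N); apply: ler_sum => k _; exact: su.
have {}cv i j : exists l : Cplx R,
    complex.Re (series u N i j) @[N --> \oo] --> complex.Re l /\
    complex.Im (series u N i j) @[N --> \oo] --> complex.Im l.
  have [a ha] := cv (fun k => complex.Re (u k i j)) (fun k =>
    le_trans (Re_le_cnorm _) (cnorm_le_nrm _ _ _)).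
  have [b hb] := cv (fun k => complex.Im (u k i j)) (fun k =>
    le_trans (Im_le_cnorm _) (cnorm_le_nrm _ _ _)).
  exists (a +i* b) => /=; split.
    by under eq_fun do rewrite /series /= summxE raddf_sum.
  by under eq_fun do rewrite /series /= summxE raddf_sum.
exists (\matrix_(i, j) projT1 (cid (cv i j))).
by apply: nrm_cvg_entries => i j; rewrite mxE; case: (cid _) => l [].
Qed.

Lemma zsum_cvg f M : bsum (fun n => nrm (f n)) M ->
  nrm (psum f N - zsum f) @[N --> \oo] --> 0.
Proof.
move=> fM.
have [N|P hP] := @cvg_abs_series (fun k => f (Posz k)) M.
  apply: le_trans (fM N); apply: ler_sum => k _; by rewrite lerDl nrm_ge0.
have [N|Q hQ] := @cvg_abs_series (fun k => f (Negz k)) M.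
  apply: le_trans (fM N); apply: ler_sum => k _; by rewrite lerDr nrm_ge0.
rewrite /zsum (nrm_cvg_lim hP) (nrm_cvg_lim hQ).
apply: (cvg0_le _ _); last first.
  exact: cvg0D hP hQ.
apply: nearW => N; rewrite nrm_ge0 /=; apply: le_trans (ler_nrmD _ _).
by rewrite /psum big_split /= opprD addrACA.
Qed.

Lemma zsumP f M S : bsum (fun n => nrm (f n)) M ->
  nrm (psum f N - S) @[N --> \oo] --> 0 -> zsum f = S.
Proof. by move=> /zsum_cvg; exact: nrm_lim_unique. Qed.

Lemma nrm_zsum_le f M : bsum (fun n => nrm (f n)) M -> nrm (zsum f) <= M.
Proof.
move=> fM; have h := zsum_cvg fM.
have h1 : M + nrm (psum f N - zsum f) @[N --> \oo] --> M.
  by rewrite -[X in _ --> X]addr0; apply: cvgD => //; exact: cvg_cst.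
apply: (cvgr_to_ge h1); apply: nearW => N.
apply: (@le_trans _ _ (nrm (psum f N) + nrm (psum f N - zsum f))).
  by apply: le_trans (ler_nrmB _ _); rewrite opprB addrC subrK.
by rewrite lerD2r; apply: le_trans (nrm_psum _ _) (fM N).
Qed.

Lemma bsum_nrmD f g M M' : bsum (fun n => nrm (f n)) M ->
  bsum (fun n => nrm (g n)) M' -> bsum (fun n => nrm (f n + g n)) (M + M').
Proof.
by move=> fM gM; apply: ler_bsum (bsumD fM gM) => n; exact: ler_nrmD.
Qed.

Lemma bsum_nrmB f g M M' : bsum (fun n => nrm (f n)) M ->
  bsum (fun n => nrm (g n)) M' -> bsum (fun n => nrm (f n - g n)) (M + M').
Proof.
by move=> fM gM; apply: ler_bsum (bsumD fM gM) => n; exact: ler_nrmB.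
Qed.

Lemma zsumD f g M M' : bsum (fun n => nrm (f n)) M ->
  bsum (fun n => nrm (g n)) M' ->
  zsum (fun n => f n + g n) = zsum f + zsum g.
Proof.
move=> fM gM; apply: zsumP (bsum_nrmD fM gM) _.
apply: (cvg0_le _ _); last first.
  exact: cvg0D (zsum_cvg fM) (zsum_cvg gM).
apply: nearW => N; rewrite nrm_ge0 /=; apply: le_trans (ler_nrmD _ _).
by rewrite psumD opprD addrACA.
Qed.

Lemma zsum_additive (h : {additive Mat R L -> Mat R L}) (c : R) f M :
  (forall A, nrm (h A) <= c * nrm A) -> bsum (fun n => nrm (f n)) M ->
  zsum (fun n => h (f n)) = h (zsum f).
Proof.
move=> hc fM; have c0 n : 0 <= `|c| * nrm (f n) by rewrite mulr_ge0 ?nrm_ge0.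
have hc' A : nrm (h A) <= `|c| * nrm A.
  by apply: le_trans (hc A) _; rewrite ler_wpM2r ?nrm_ge0 ?ler_norm.
have hM : bsum (fun n => nrm (h (f n))) (`|c| * M).
  by apply: ler_bsum (bsumMl (normr_ge0 c) fM) => n.
apply: zsumP hM _.
apply: (cvg0_le _ _); last first.
  by rewrite -(mulr0 `|c|); apply: cvgMr (zsum_cvg fM).
apply: nearW => N; rewrite nrm_ge0 /=; apply: le_trans (hc' _).
by rewrite raddfB (raddf_psum h).
Qed.

Lemma zsumN f M : bsum (fun n => nrm (f n)) M ->
  zsum (fun n => - f n) = - zsum f.
Proof.
by apply: (@zsum_additive -%R 1) => A; rewrite nrmN mul1r.
Qed.

Lemma zsumB f g M M' : bsum (fun n => nrm (f n)) M ->
  bsum (fun n => nrm (g n)) M' ->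
  zsum (fun n => f n - g n) = zsum f - zsum g.
Proof.
move=> fM gM; rewrite (@zsumD _ (fun n => - g n) M M') // ?(zsumN gM) //.
by under eq_fun do rewrite nrmN.
Qed.

Lemma zsumZ (a : Cplx R) f M : bsum (fun n => nrm (f n)) M ->
  zsum (fun n => a *: f n) = a *: zsum f.
Proof.
by apply: (@zsum_additive (GRing.scale a) (cnorm a)) => A; rewrite nrmZ.
Qed.

Lemma zsum_fin f N : (forall n, ~~ in_window N n -> f n = 0) ->
  zsum f = psum f N.
Proof.
move=> f0; have fM : bsum (fun n => nrm (f n)) (psum (fun n => nrm (f n)) N).
  move=> N'; apply: le_trans (psum_homo (fun n => nrm_ge0 _) (leq_maxl N' N)) _.
  rewrite (@psum_stable _ _ N) ?leq_maxr // => n /f0 ->; exact: nrm0.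
apply: zsumP fM _; apply/cvgr0Pnorm_lt => e e0; near=> N'.
rewrite (psum_stable f0) ?subrr ?nrm0 ?normr0 //.
by near: N'; exact: nbhs_infty_ge.
Unshelve. all: by end_near. Qed.

Lemma zsum_point f r : (forall n, n != r -> f n = 0) -> zsum f = f r.
Proof.
move=> f0; have [N rN] := in_window_ex r.
rewrite (@zsum_fin _ N); last first.
  by move=> n nN; apply: f0; apply: contraNneq nN => ->.
have g0 : psum (fun n => f n - (if n == r then f r else 0)) N = 0.
  rewrite /psum big1 // => k _.
  have z n : f n - (if n == r then f r else 0) = 0.
    by case: eqP => [->|/eqP /f0 ->]; rewrite subrr.
  by rewrite !z addr0.
apply/eqP; rewrite -subr_eq0 -g0 psumB; apply/eqP; congr (_ - _).
rewrite psum_windowE.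
have [[b0 k0] /= E0] : exists p : bool * 'I_N, (if p.1 then Posz p.2 else Negz p.2) = r.
  by case: (r) rN => k kN; [exists (true, Ordinal kN)|exists (false, Ordinal kN)].
rewrite (bigD1 (b0, k0)) //= E0 eqxx big1 ?addr0 // => -[b k] /= ne.
case: eqP => // E; case/eqP: ne; move: E; rewrite -E0.
by case: b; case: b0 {E0} => // -[] /val_inj ->.
Qed.

End IntegerSums.

(** * Free resolvent *)

Section Green.
Context {R : realType} {L : nat}.
Implicit Types (z : Cplx R) (A : Mat R L) (f F W v : Seq R L) (M : R).

(* With [z + z^-1 = E], this is the decaying or outgoing fundamental solution
   [z ^ |n| / (z - z^-1)] of the free equation [u(n+1) + u(n-1) - E u(n) = delta_0(n)]. *)
Definition green z (n : int) : Cplx R := z ^+ `|n|.+1 / (z ^+ 2 - 1).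

Lemma cnorm_green_le z n : cnorm z <= 1 ->
  cnorm (green z n) <= (cnorm (z ^+ 2 - 1))^-1.
Proof.
move=> z1; rewrite /green cnormM cnormX cnormV ler_piMl ?invr_ge0 ?cnorm_ge0 //.
by rewrite exprn_ile1 ?cnorm_ge0.
Qed.

(** Away from 0 the terms are consecutive powers of z on either half-line, and they cancel by [key].
    At 0 the kink of |n| leaves (2 z^2 - (z^2 + 1)) / (z^2 - 1) = 1. *)
Lemma green_eq z n : z != 0 -> z ^+ 2 != 1 ->
  green z (n + 1) + green z (n - 1) - (z + z^-1) * green z n = (n == 0)%:R.
Proof.
move=> z0 z1; have z1' : z ^+ 2 - 1 != 0 by rewrite subr_eq0.
have nz : z * z^-1 = 1 by rewrite mulfV.
have key w : z * (z * (z * w)) / (z ^+ 2 - 1) + z * w / (z ^+ 2 - 1) -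
    (z + z^-1) * (z * (z * w) / (z ^+ 2 - 1)) = 0.
  by field; rewrite z0 z1'.
rewrite /green; case: n => [[|m]|m].
- have -> : absz (Posz 0 + 1) = 1%N by [].
  have -> : absz (Posz 0 - 1) = 1%N by [].
  by rewrite /=; field; rewrite z0 z1'.
- have -> : absz (Posz m.+1 + 1) = m.+2 by lia.
  have -> : absz (Posz m.+1 - 1) = m by lia.
  by rewrite [absz _]/= (exprS z m.+2) (exprS z m.+1) (exprS z m) key.
- have -> : absz (Negz m + 1) = m by lia.
  have -> : absz (Negz m - 1) = m.+2 by lia.
  rewrite [absz _]/= (exprS z m.+2) (exprS z m.+1) (exprS z m).
  by rewrite [X in X - _]addrC key.
Qed.

Definition conv z F : Seq R L := fun n => zsum (fun k => green z (n - k) *: F k).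

Lemma bsum_scale (c : R) (s : int -> Cplx R) F M :
  (forall k, cnorm (s k) <= c) -> bsum (fun n => nrm (F n)) M ->
  bsum (fun k => nrm (s k *: F k)) (c * M).
Proof.
move=> sc FM; have c0 : 0 <= c := le_trans (cnorm_ge0 _) (sc 0).
by apply: ler_bsum (bsumMl c0 FM) => k; rewrite nrmZ ler_wpM2r ?nrm_ge0.
Qed.

Lemma bsum_green z F M n : cnorm z <= 1 -> bsum (fun n => nrm (F n)) M ->
  bsum (fun k => nrm (green z (n - k) *: F k)) ((cnorm (z ^+ 2 - 1))^-1 * M).
Proof. by move=> z1; apply: bsum_scale => k; exact: cnorm_green_le. Qed.

Lemma nrm_conv_le z F M n : cnorm z <= 1 -> bsum (fun n => nrm (F n)) M ->
  nrm (conv z F n) <= (cnorm (z ^+ 2 - 1))^-1 * M.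
Proof. by move=> z1 FM; apply: nrm_zsum_le; exact: bsum_green. Qed.

Lemma conv_eq z F M n : z != 0 -> z ^+ 2 != 1 -> cnorm z <= 1 ->
  bsum (fun n => nrm (F n)) M ->
  conv z F (n + 1) + conv z F (n - 1) - (z + z^-1) *: conv z F n = F n.
Proof.
move=> z0 z1 zle FM; rewrite /conv.
rewrite -(zsumZ _ (bsum_green n zle FM)).
have b1 := bsum_green (n + 1) zle FM; have b2 := bsum_green (n - 1) zle FM.
rewrite -(zsumD b1 b2).
rewrite -(zsumB (bsum_nrmD b1 b2)
  (M' := cnorm (z + z^-1) * ((cnorm (z ^+ 2 - 1))^-1 * M))); last first.
  exact: (@bsum_scale (cnorm (z + z^-1)) (fun=> z + z^-1) _ _
    (fun=> lexx _) (bsum_green n zle FM)).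
rewrite (@zsum_point _ _ _ n) => [|k kn].
  rewrite scalerA -scalerDl -scalerBl.
  have -> : n + 1 - n = n - n + 1 by rewrite addrAC.
  have -> : n - 1 - n = n - n - 1 by rewrite addrAC.
  by rewrite green_eq // subrr eqxx scale1r.
rewrite scalerA -scalerDl -scalerBl.
have -> : n + 1 - k = n - k + 1 by rewrite addrAC.
have -> : n - 1 - k = n - k - 1 by rewrite addrAC.
by rewrite green_eq // subr_eq0 eq_sym (negbTE kn) scale0r.
Qed.

Lemma convB z F F' M M' : cnorm z <= 1 ->
  bsum (fun n => nrm (F n)) M -> bsum (fun n => nrm (F' n)) M' ->
  conv z (fun n => F n - F' n) = (fun n => conv z F n - conv z F' n).
Proof.
move=> z1 FM FM'; apply/funext => n.
rewrite /conv -(zsumB (bsum_green n z1 FM) (bsum_green n z1 FM')).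
by congr zsum; apply/funext => k; rewrite scalerBr.
Qed.

Lemma convD z F F' M M' : cnorm z <= 1 ->
  bsum (fun n => nrm (F n)) M -> bsum (fun n => nrm (F' n)) M' ->
  conv z (fun n => F n + F' n) = (fun n => conv z F n + conv z F' n).
Proof.
move=> z1 FM FM'; apply/funext => n.
rewrite /conv -(zsumD (bsum_green n z1 FM) (bsum_green n z1 FM')).
by congr zsum; apply/funext => k; rewrite scalerDr.
Qed.

Lemma convZ z (a : Cplx R) F M : cnorm z <= 1 -> bsum (fun n => nrm (F n)) M ->
  conv z (fun n => a *: F n) = (fun n => a *: conv z F n).
Proof.
move=> z1 FM; apply/funext => n.
rewrite /conv -(zsumZ _ (bsum_green n z1 FM)).
by congr zsum; apply/funext => k; rewrite !scalerA mulrC.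
Qed.

Lemma zsum_dominated0 {T : Type} {D : set_system T} {DF : ProperFilter D}
    (f : T -> Seq R L) (q : int -> R) M :
  (forall t n, nrm (f t n) <= q n) -> bsum q M ->
  (forall n, nrm (f t n) @[t --> D] --> 0) ->
  nrm (zsum (f t)) @[t --> D] --> 0.
Proof.
move=> fq qM f0; apply/cvgr0Pnorm_le => e e0.
have h : \forall t \near D, bsum (fun n => nrm (f t n)) e.
  exact: (dominated_bsum (fun t n => nrm_ge0 (f t n)) fq qM f0 e0).
by apply: filterS h => t /nrm_zsum_le; rewrite ger0_norm ?nrm_ge0.
Qed.

Lemma exchange_psum (a : int -> int -> R) N K :
  psum (fun n => psum (a n) K) N = psum (fun k => psum (a^~ k) N) K.
Proof.
elim: K => [|K IH].
  rewrite psum0 (eq_psum (g := fun=> 0)) => [|n _]; last exact: psum0.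
  by rewrite /psum big1 // => k _; rewrite addr0.
rewrite psumS -IH -!psumD; apply: eq_psum => n _; exact: psumS.
Qed.

(** Young's inequality for the geometrically decaying kernel. It puts bounded solutions with |z| < 1
    into l2, which links [sol] with eigenfunctions and with the resolvent. *)
Lemma conv_l1 z F M : cnorm z < 1 -> bsum (fun n => nrm (F n)) M ->
  exists M', bsum (fun n => nrm (conv z F n)) M'.
Proof.
move=> z1 FM; have zle := ltW z1; set c := (cnorm (z ^+ 2 - 1))^-1.
have c0 : 0 <= c by rewrite invr_ge0 cnorm_ge0.
pose g (n : int) : R := c * cnorm z ^+ `|n|.
have g0 n : 0 <= g n by rewrite mulr_ge0 ?exprn_ge0 ?cnorm_ge0.
have gM : bsum g (c * (2 / (1 - cnorm z))).
  by apply: bsumMl => //; apply: bsum_geometric; rewrite cnorm_ge0.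
have gg n : cnorm (green z n) <= g n.
  rewrite /green cnormM cnormX cnormV mulrC ler_wpM2l // exprS.
  by rewrite ler_piMl ?exprn_ge0 ?cnorm_ge0.
set Mg := c * _ in gM; exists (M * Mg) => N.
(* The two sums are interchanged only for finite windows; the error of cutting the inner sum at [K]
   tends to 0 for fixed [N]. *)
have h : M * Mg + psum (fun n => nrm (psum (fun k => green z (n - k) *: F k) K -
    conv z F n)) N @[K --> \oo] --> M * Mg.
  rewrite -[X in _ --> X](addr0 (M * Mg)); apply: cvgD; first exact: cvg_cst.
  apply: (@cvg_psum0 R nat \oo _ (fun K n => nrm (psum (fun k => green z (n - k) *: F k) K -
    conv z F n))) => n.
  exact: zsum_cvg (bsum_green n zle FM).
apply: (cvgr_to_ge h); apply: nearW => K.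
apply: (@le_trans _ _ (psum (fun n => nrm (psum (fun k => green z (n - k) *: F k) K) +
    nrm (psum (fun k => green z (n - k) *: F k) K - conv z F n)) N)).
  apply: ler_psum => n; apply: le_trans (ler_nrmB _ _).
  by rewrite opprB addrC subrK.
rewrite psumD lerD2r.
apply: (@le_trans _ _ (psum (fun n => psum (fun k => g (n - k) * nrm (F k)) K) N)).
  apply: ler_psum => n; apply: le_trans (nrm_psum _ _) _.
  by apply: ler_psum => k; rewrite nrmZ ler_wpM2r ?nrm_ge0.
rewrite exchange_psum; apply: (@le_trans _ _ (psum (fun k => Mg * nrm (F k)) K)).
  apply: ler_psum => k.
  rewrite (eq_psum (g := fun n => nrm (F k) * g (n - k))) => [|n _]; last by rewrite mulrC.
  rewrite psumMl mulrC ler_wpM2r ?nrm_ge0 //; exact: (bsum_shift (- k) g0 gM).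
rewrite psumMl mulrC ler_wpM2r ?FM //.
exact: bsum_ge0 gM.
Qed.

End Green.

(** * The Joukowski parametrization of the spectral parameter *)

Section JostParameter.
Context {R : realType}.
Implicit Types (E z : Cplx R) (b : bool).

(* [z ^+ 2 != 1] excludes exactly the thresholds [E = 2] and [E = -2]. *)
Definition jost b E z := [/\ z != 0, z + z^-1 = E, cnorm z <= 1,
  (-1) ^+ b * complex.Im z <= 0 & z ^+ 2 != 1].

(** For |z| < 1 the factor is negative, which explains the opposite signs of Im z and Im E in
    [jost]. On the unit circle it vanishes, and there the sign condition is what distinguishes z
    from its inverse. *)
Lemma Im_joukowski z : z != 0 ->
  complex.Im (z + z^-1) = (1 - (cnorm z ^+ 2)^-1) * complex.Im z.
Proof.
move=> z0; rewrite raddfD /=; case: z z0 => x y z0 /=.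
rewrite sqr_sqrtr ?addr_ge0 ?sqr_ge0 //; ring.
Qed.

Lemma Re_joukowski z : z != 0 ->
  complex.Re (z + z^-1) = (1 + (cnorm z ^+ 2)^-1) * complex.Re z.
Proof.
move=> z0; rewrite raddfD /=; case: z z0 => x y z0 /=.
rewrite sqr_sqrtr ?addr_ge0 ?sqr_ge0 //; ring.
Qed.

Lemma in_segmentE E :
  (-2 < E < 2) = (complex.Im E == 0) && (-2 < complex.Re E < 2).
Proof.
have -> : (2 : Cplx R) = 2%:C by rewrite rmorph_nat.
case: E => x y; rewrite !ltcE /= oppr0 [0 == y]eq_sym.
by case: (y == 0).
Qed.

Lemma signb_sqr b : ((-1) ^+ b : R) * (-1) ^+ b = 1.
Proof. by case: b; rewrite ?expr0 ?expr1 ?mulrNN ?mulr1. Qed.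

(** The two roots of z^2 - E z + 1 have product 1, so one of them lies in the closed disc. Inside
    the disc its sign is forced by that of Im E; on the circle either it or its inverse has the
    required sign. *)
Lemma jost_exists b E : 0 <= (-1) ^+ b * complex.Im E -> E != 2 -> E != -2 ->
  exists z, jost b E z.
Proof.
move=> sE E2 E2'.
pose s : Cplx R := sqrtC (E ^+ 2 - 4); pose z1 := (E + s) / 2; pose z2 := (E - s) / 2.
have ss : s ^+ 2 = E ^+ 2 - 4 by rewrite /s sqrtCK.
have two : (2 : Cplx R) != 0 by rewrite pnatr_eq0.
have z12 : z1 * z2 = 1.
  have -> : z1 * z2 = (E ^+ 2 - s ^+ 2) / 4 by rewrite /z1 /z2; field.
  by rewrite ss; field.
have z1D : z1 + z2 = E by rewrite /z1 /z2; field.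
have [z [z0 zE z1le]] : exists z, [/\ z != 0, z + z^-1 = E & cnorm z <= 1].
  have z10 : z1 != 0 by apply: contra_eq_neq z12 => ->; rewrite mul0r eq_sym oner_neq0.
  have z20 : z2 != 0 by apply: contra_eq_neq z12 => ->; rewrite mulr0 eq_sym oner_neq0.
  have z1V : z1^-1 = z2 by apply: (mulfI z10); rewrite mulfV.
  have [le1|gt1] := lerP (cnorm z1) 1; first by exists z1; rewrite z1V.
  have z2V : z2^-1 = z1 by rewrite -z1V invrK.
  exists z2; split; rewrite ?z2V // 1?addrC //.
  by rewrite -z1V cnormV invf_le1 ?ltW // (lt_trans _ gt1).
have nz1 : z ^+ 2 != 1.
  rewrite sqrf_eq1; apply/norP; split; apply/eqP => zz; subst z.
    by case/eqP: E2; rewrite -zE invr1.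
  by case/eqP: E2'; rewrite -zE invrN invr1 -opprD.
have [zlt|] := ltrP (cnorm z) 1.
  exists z; split=> //; move: sE; rewrite -zE (Im_joukowski z0).
  have h : 1 < (cnorm z ^+ 2)^-1.
    by rewrite invf_gt1 ?exprn_gt0 ?cnorm_gt0 // exprn_ilt1 ?cnorm_ge0.
  have h1 : 1 - (cnorm z ^+ 2)^-1 < 0 by rewrite subr_lt0.
  by rewrite mulrCA (nmulr_rge0 _ h1).
move=> zge; have {zge}z1' : cnorm z = 1 by apply/eqP; rewrite eq_le z1le.
have [zs|zs] := lerP ((-1) ^+ b * complex.Im z) 0; first by exists z.
exists z^-1; split; rewrite ?invr_eq0 ?invrK 1?addrC ?cnormV ?z1' ?invr1 //.
  have := Im_joukowski z0; rewrite z1' expr1n invr1 subrr mul0r raddfD /=.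
  rewrite addrC => /eqP; rewrite addr_eq0 => /eqP ->; rewrite mulrN; lra.
by rewrite exprVn invr_eq1.
Qed.

(** On the unit circle z + z^-1 = 2 Re z, which lies strictly between -2 and 2 as z is not 1 or
    -1. *)
Lemma jost_cnorm_lt1 b E z : jost b E z -> ~ (-2 < E < 2) -> cnorm z < 1.
Proof.
case=> z0 zE z1 _ nz1 nE; rewrite lt_neqAle z1 andbT; apply/eqP => zz.
apply: nE; have I0 := Im_joukowski z0; have R0 := Re_joukowski z0.
move: I0 R0; rewrite zE zz expr1n invr1 subrr mul0r => I0 R0.
have h : complex.Re z ^+ 2 + complex.Im z ^+ 2 = 1 by rewrite -cnorm_sqr zz expr1n.
have hI : complex.Im z != 0.
  apply/eqP => Iz; move: h nz1; rewrite Iz expr0n addr0 => h.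
  have -> : z = (complex.Re z)%:C by case: (z) Iz => x y /= ->.
  by rewrite -rmorphXn h eqxx.
have hR : -1 < complex.Re z < 1.
  by rewrite -ltr_norml -(@ltr_pXn2r _ 2) ?nnegrE // expr1n real_normK ?num_real //
    -h ltrDl exprn_even_gt0.
rewrite in_segmentE I0 eqxx R0 /=; lra.
Qed.

(** The identities (z - 1)^2 = (E - 2) z and (z + 1)^2 = (E + 2) z reduce everything to a lower
    bound on |z|, which comes from |z^-1| = |E - z| <= B + 1. *)
Lemma jost_away b E z (d B : R) : jost b E z -> cnorm E <= B ->
  d <= cnorm (E - 2) -> d <= cnorm (E + 2) -> 0 <= d ->
  [/\ d / (B + 1) <= cnorm (z - 1) ^+ 2, d / (B + 1) <= cnorm (z + 1) ^+ 2 &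
   d / (B + 1) <= cnorm (z ^+ 2 - 1)].
Proof.
case=> z0 zE z1 _ nz1 EB d1 d2 d0.
have B0 : 0 <= B := le_trans (cnorm_ge0 _) EB.
have zB : (B + 1)^-1 <= cnorm z.
  have cz : 0 < cnorm z by rewrite cnorm_gt0.
  rewrite -[cnorm z]invrK lef_pV2 ?posrE ?invr_gt0 //; last lra.
  rewrite -cnormV; have -> : z^-1 = E - z by rewrite -zE addrC addKr.
  by apply: le_trans (ler_cnormB _ _) _; rewrite lerD.
have e1 : cnorm (z - 1) ^+ 2 = cnorm (E - 2) * cnorm z.
  by rewrite -cnormX -cnormM -zE; congr cnorm; field.
have e2 : cnorm (z + 1) ^+ 2 = cnorm (E + 2) * cnorm z.
  by rewrite -cnormX -cnormM -zE; congr cnorm; field.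
have iB : 0 <= (B + 1)^-1 by rewrite invr_ge0; lra.
have h1 : d / (B + 1) <= cnorm (z - 1) ^+ 2 by rewrite e1; apply: ler_pM.
have h2 : d / (B + 1) <= cnorm (z + 1) ^+ 2 by rewrite e2; apply: ler_pM.
have dB : 0 <= d / (B + 1) by rewrite mulr_ge0.
split=> //; rewrite -(@ler_pXn2r _ 2) ?nnegrE ?cnorm_ge0 //.
have -> : z ^+ 2 - 1 = (z - 1) * (z + 1) by ring.
by rewrite cnormM [leRHS]exprMn expr2; apply: ler_pM.
Qed.

(** Since (z - z') (z z' - 1) = (E - E') z z', the Lipschitz bound can fail only where z' is near
    z^-1; the common half-disc and the distance of z from 1 and -1 exclude this. *)
Lemma jost_lipschitz b E E' z z' (d : R) : jost b E z -> jost b E' z' -> 0 < d ->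
  d <= cnorm (z - 1) ^+ 2 -> d <= cnorm (z + 1) ^+ 2 ->
  cnorm (z - z') <= 2 / d * cnorm (E - E').
Proof.
case=> z0 zE z1 zs _ [z0' zE' z1' zs' _] d0 d1 d2.
have e : (z - z') * (z * z' - 1) = (E - E') * (z * z').
  by rewrite -zE -zE'; field; rewrite z0 z0'.
(* As [z] and [z'] lie in the same closed half-disc, [Re (z z') <= |Re z|]. *)
have low : d / 2 <= cnorm (z * z' - 1).
  rewrite cnormBC; apply: le_trans (le_trans (ler_norm _) (Re_le_cnorm _)).
  have bb : 0 <= complex.Im z * complex.Im z'.
    by rewrite -[complex.Im z * _]mul1r -(signb_sqr b) mulrACA mulr_le0.
  have az := Re_le_cnorm z'.
  have h := cnorm_sqr z; have h1 := cnorm_sqr (z - 1); have h2 := cnorm_sqr (z + 1).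
  have zz : cnorm z ^+ 2 <= 1 by rewrite exprn_ile1 ?cnorm_ge0.
  move: h h1 h2 zz; rewrite !raddfD !raddfN /= => h h1 h2 zz.
  have -> : complex.Re (z * z') = complex.Re z * complex.Re z' - complex.Im z * complex.Im z'.
    by case: (z) (z') => x y [x' y'].
  have : complex.Re z * complex.Re z' <= `|complex.Re z|.
    apply: le_trans (ler_norm _) _; rewrite normrM ler_piMr //.
    exact: le_trans az z1'.
  have : `|complex.Re z| <= 1 - d / 2.
    by rewrite ler_norml; apply/andP; split; nra.
  lra.
rewrite mulrAC ler_pdivlMr // -ler_pdivrMl //.
have : cnorm (z - z') * cnorm (z * z' - 1) = cnorm (E - E') * cnorm (z * z').
  by rewrite -!cnormM e.
have : cnorm (z * z') <= 1 by rewrite cnormM mulr_ile1 ?cnorm_ge0.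
have := cnorm_ge0 (z - z'); have := cnorm_ge0 (E - E').
set a := cnorm _; set c := cnorm _; set p := cnorm (z * z'); set t := cnorm (z * z' - 1).
move=> a0 c0 p1 ct.
have : c * (d / 2) <= c * t by rewrite ler_wpM2l.
have : a * p <= a by rewrite ler_piMr.
by rewrite ct; lra.
Qed.

End JostParameter.

(** * Hoelder dependence of the fundamental solution on its parameter *)

Section HoelderGreen.
Context {R : realType}.
Implicit Types (z : Cplx R) (beta : R).

Lemma cnorm_subX_le z z' m : cnorm z <= 1 -> cnorm z' <= 1 ->
  cnorm (z ^+ m - z' ^+ m) <= m%:R * cnorm (z - z').
Proof.
move=> z1 z1'; elim: m => [|m IH]; first by rewrite !expr0 subrr cnorm0 mul0r.
have -> : z ^+ m.+1 - z' ^+ m.+1 = z ^+ m * (z - z') + (z ^+ m - z' ^+ m) * z'.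
  by rewrite !exprSr; ring.
apply: le_trans (ler_cnormD _ _) _; rewrite !cnormM -natr1 mulrDl mul1r addrC lerD //.
  by apply: le_trans IH; rewrite ler_piMr ?cnorm_ge0.
by rewrite ler_piMl ?cnorm_ge0 // cnormX exprn_ile1 ?cnorm_ge0.
Qed.

(** Interpolation between a trivial and a Lipschitz bound: for y <= 1 one has y <= y^beta because
    beta <= 1, and for y > 1 the trivial bound 2 suffices. *)
Lemma min_le_powR (x y beta : R) : 0 < beta <= 1 -> 0 <= y -> x <= 2 -> x <= y ->
  x <= 2 * y `^ beta.
Proof.
move=> /andP[b0 b1] y0 x2 xy; have [y1|y1] := lerP y 1.
  have [y00|yn0] := eqVneq y 0; first by move: xy; rewrite y00 powR0 ?mulr0 ?gt_eqF.
  apply: le_trans xy _; apply: (@le_trans _ _ (y `^ beta)).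
    by apply: ger1_powR => //; rewrite lt_def yn0 y0.
  by have := powR_ge0 y beta; lra.
apply: le_trans x2 _; rewrite ler_peMr //.
by have := @ge0_ler_powR R beta (ltW b0) 1 y; rewrite powR1 !nnegrE => ->; lra.
Qed.

Lemma cnorm_subX_hoelder z z' m beta : 0 < beta <= 1 ->
  cnorm z <= 1 -> cnorm z' <= 1 ->
  cnorm (z ^+ m - z' ^+ m) <= 2 * (m%:R `^ beta * cnorm (z - z') `^ beta).
Proof.
move=> hb z1 z1'; rewrite -powRM ?cnorm_ge0 //.
apply: min_le_powR; rewrite ?mulr_ge0 ?cnorm_ge0 //; last exact: cnorm_subX_le.
apply: le_trans (ler_cnormB _ _) _; rewrite !cnormX.
have := @exprn_ile1 R m _ (cnorm_ge0 z) z1.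
by have := @exprn_ile1 R m _ (cnorm_ge0 z') z1'; lra.
Qed.

Lemma green_hoelder z z' (d beta : R) n : 0 < beta <= 1 -> 0 < d ->
  cnorm z <= 1 -> cnorm z' <= 1 ->
  d <= cnorm (z ^+ 2 - 1) -> d <= cnorm (z' ^+ 2 - 1) ->
  cnorm (green z n - green z' n) <=
    (2 / d + 4 / d ^+ 2) * (cnorm (z - z') `^ beta * (1 + `|n|%N%:R) `^ beta).
Proof.
move=> hb d0 z1 z1' dz dz'.
have /andP[b0 b1] := hb.
have cz : 0 < cnorm (z ^+ 2 - 1) := lt_le_trans d0 dz.
have cz' : 0 < cnorm (z' ^+ 2 - 1) := lt_le_trans d0 dz'.
have nz : z ^+ 2 - 1 != 0 by rewrite -cnorm_gt0.
have nz' : z' ^+ 2 - 1 != 0 by rewrite -cnorm_gt0.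
set m := `|n|%N.
(* The first quotient varies the numerator and yields 2/d; the second varies the denominator and
   yields 4/d^2, where 4 bounds 2 * 2^beta. *)
have -> : green z n - green z' n = (z ^+ m.+1 - z' ^+ m.+1) / (z ^+ 2 - 1) -
    z' ^+ m.+1 * (z ^+ 2 - z' ^+ 2) / ((z ^+ 2 - 1) * (z' ^+ 2 - 1)).
  rewrite /green -/m; set a := z ^+ m.+1; set a' := z' ^+ m.+1.
  by field; rewrite nz nz'.
apply: le_trans (ler_cnormB _ _) _; rewrite [leRHS]mulrDl; apply: lerD.
  rewrite cnormM cnormV [leRHS]mulrAC ler_pM ?cnorm_ge0 ?invr_ge0 ?cnorm_ge0 //.
    have -> : 1 + m%:R = m.+1%:R :> R by rewrite -natr1 addrC.
    rewrite [cnorm (z - z') `^ _ * _]mulrC; exact: cnorm_subX_hoelder.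
  by rewrite lef_pV2 ?posrE.
rewrite !cnormM cnormV cnormM cnormX.
have h1 : 1 <= (1 + m%:R) `^ beta :> R.
  have := @ge0_ler_powR R beta (ltW b0) 1 (1 + m%:R); rewrite powR1 !nnegrE => -> //.
  by rewrite lerDl.
have h2 : 2 `^ beta <= 2 :> R.
  by rewrite -[leRHS](powRr1 (ler0n R 2)); apply: ler_powR => //; rewrite ler1n.
have h3 : cnorm (z ^+ 2 - z' ^+ 2) <= 4 * (cnorm (z - z') `^ beta * (1 + m%:R) `^ beta).
  apply: le_trans (cnorm_subX_hoelder 2 hb z1 z1') _.
  have h4 := powR_ge0 (cnorm (z - z')) beta; nra.
have h5 : cnorm z' ^+ m.+1 <= 1 by rewrite exprn_ile1 ?cnorm_ge0.
have h6 : (cnorm (z ^+ 2 - 1) * cnorm (z' ^+ 2 - 1))^-1 <= (d ^+ 2)^-1.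
  rewrite lef_pV2 ?posrE ?mulr_gt0 ?exprn_gt0 // expr2; apply: ler_pM => //; exact: ltW.
rewrite [leRHS]mulrAC; apply: ler_pM => //.
- by rewrite mulr_ge0 ?exprn_ge0 ?cnorm_ge0.
- by rewrite invr_ge0 mulr_ge0 ?cnorm_ge0.
- rewrite -[leRHS]mul1r; apply: ler_pM => //; rewrite ?exprn_ge0 ?cnorm_ge0 //.
Qed.

End HoelderGreen.

(** * Current and uniqueness of bounded solutions *)

Section SquareSummable.
Context {R : realType} {L : nat}.
Implicit Types (u v : Seq R L) (M c : R).

Lemma l2norm_le_bsum u c : 0 <= c ->
  (l2norm u <= c%:E)%E <-> bsum (fun n => mat_norm (u n) ^+ 2) (c ^+ 2).
Proof.
move=> c0; rewrite -esum_le_bsum => [|n]; last exact: sqr_ge0.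
rewrite /l2norm; set S := esum _ _.
have S0 : (0 <= S)%E by apply: esum_ge0 => n _; rewrite lee_fin sqr_ge0.
case: S S0 => [s| |] //=; last by rewrite invr_eq0 pnatr_eq0.
rewrite !lee_fin => s0; rewrite powR12_sqrt // -(@ler_pXn2r _ 2) ?nnegrE ?sqrtr_ge0 //.
by rewrite sqr_sqrtr.
Qed.

Lemma l2_bsum u : l2 u <-> exists M, bsum (fun n => mat_norm (u n) ^+ 2) M.
Proof.
split=> [|[M uM]].
  rewrite /l2 /= /l2norm => /lty_poweRy h.
  by apply: esum_lty_bsum => [n|]; [exact: sqr_ge0|apply: h; rewrite invr_eq0].
rewrite /l2 /=; apply: (@le_lt_trans _ _ (1 + M)%:E); last by rewrite ltry.
have M0 := bsum_ge0 uM.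
apply/l2norm_le_bsum; first lra; move=> N; apply: le_trans (uM N) _; nra.
Qed.

Lemma bsum_l2 u M B : (forall n, nrm (u n) <= B) ->
  bsum (fun n => nrm (u n)) M -> l2 u.
Proof.
move=> uB uM; apply/l2_bsum; exists (B * M).
have B0 : 0 <= B := le_trans (nrm_ge0 _) (uB 0).
apply: ler_bsum (bsumMl B0 uM) => n; rewrite expr2.
by apply: ler_pM; rewrite ?mat_norm_ge0 ?mat_norm_le_nrm //;
  apply: le_trans (mat_norm_le_nrm _) (uB n).
Qed.

Lemma bsum_cvg0 (a : int -> R) M : (forall n, 0 <= a n) -> bsum a M ->
  a (Posz k) @[k --> \oo] --> 0 /\ a (Negz k) @[k --> \oo] --> 0.
Proof.
move=> a0 aM; have main e : 0 < e -> \forall k \near \oo, a (Posz k) + a (Negz k) <= e.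
  move=> e0; have [N hN] := bsum_tail a0 aM e0; near=> k.
  apply: le_trans (hN k.+1); rewrite psumS addrAC lerDr subr_ge0.
  by apply: psum_homo => //; near: k; exact: nbhs_infty_ge.
by split; apply/cvgr0Pnorm_le => e /main; apply: filterS => k;
  rewrite ger0_norm //; apply: le_trans; rewrite ?lerDl ?lerDr.
Unshelve. all: by end_near. Qed.

Lemma bsum_off_window (q : int -> R) M e : (forall n, 0 <= q n) -> bsum q M ->
  0 < e -> exists N, bsum (fun n => if in_window N n then 0 else q n) e.
Proof.
move=> q0 qM e0; have [N hN] := bsum_tail q0 qM e0; exists N => N'.
have [N'N|/ltnW NN'] := leqP N' N.
  rewrite (eq_psum (g := fun=> 0)) => [|n nN']; last by rewrite (in_windowW N'N).
  by rewrite /psum big1 ?ltW // => k _; rewrite addr0.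
apply: le_trans (hN N').
elim: N' NN' => [|m IH]; first by rewrite leqn0 => /eqP ->; rewrite !psum0 subrr.
rewrite leq_eqVlt => /predU1P[<-|].
  rewrite subrr (eq_psum (g := fun=> 0)) => [|n ->//].
  by rewrite /psum big1 // => k _; rewrite addr0.
rewrite ltnS => Nm; rewrite !psumS /= ltnNge Nm /=; have := IH Nm; lra.
Qed.

End SquareSummable.

Section Current.
Context {R : realType} {L : nat}.
Implicit Types (A B C U : Mat R L) (u v V : Seq R L) (E z : Cplx R).

Lemma mat_dotDl A B C : mat_dot (A + B) C = mat_dot A C + mat_dot B C.
Proof. by rewrite /mat_dot mulmxDr mxtraceD. Qed.

Lemma mat_dotZl (a : Cplx R) A B : mat_dot (a *: A) B = a * mat_dot A B.
Proof. by rewrite /mat_dot -scalemxAr mxtraceZ. Qed.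

Lemma mat_dotE A B : mat_dot A B = \sum_j \sum_i Num.conj (B i j) * A i j.
Proof.
by apply: eq_bigr => j _; rewrite mxE; apply: eq_bigr => i _; rewrite !mxE.
Qed.

Lemma mat_dotC A B : mat_dot A B = Num.conj (mat_dot B A).
Proof.
rewrite !mat_dotE rmorph_sum; apply: eq_bigr => j _.
rewrite rmorph_sum; apply: eq_bigr => i _.
by case: (A i j) (B i j) => a b [c d]; apply/eqP; rewrite eq_complex /=;
  apply/andP; split; apply/eqP; ring.
Qed.

Lemma Im_conjc (x : Cplx R) : complex.Im (Num.conj x) = - complex.Im x.
Proof. by case: x. Qed.

Lemma Im_mat_dot_self A : complex.Im (mat_dot A A) = 0.
Proof.
have : complex.Im (mat_dot A A) = - complex.Im (mat_dot A A).
  by rewrite {1}mat_dotC Im_conjc.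
lra.
Qed.

Lemma Re_mat_dot_self A : complex.Re (mat_dot A A) = mat_norm A ^+ 2.
Proof.
rewrite /mat_norm sqr_sqrtr // Re_mat_dot.
by apply: sumr_ge0 => i _; apply: sumr_ge0 => j _; rewrite sqr_ge0.
Qed.

Lemma cnorm_mat_dot_le A B : cnorm (mat_dot A B) <= nrm A * nrm B.
Proof.
rewrite mat_dotE exchange_big /= /nrm mulr_suml.
apply: le_trans (ler_cnorm_sum _ _ _) _; apply: ler_sum => i _.
apply: le_trans (ler_cnorm_sum _ _ _) _; rewrite mulr_suml.
apply: ler_sum => j _; rewrite cnormM mulrC ler_wpM2l ?cnorm_ge0 //.
apply: le_trans (cnorm_le_nrm B i j).
by case: (B i j) => x y /=; rewrite sqrrN.
Qed.

Lemma Im_mat_dot_hermitian U A : U \is hermsymmx ->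
  complex.Im (mat_dot (U *m A) A) = 0.
Proof.
move/is_hermitianmxP; rewrite expr0 scale1r => hU.
have conjT (n m p : nat) (X : 'M[Cplx R]_(n, m)) (Y : 'M[Cplx R]_(m, p)) :
    map_mx Num.conj (X *m Y) = map_mx Num.conj X *m map_mx Num.conj Y.
  exact: map_mxM.
have e : mat_dot (U *m A) A = mat_dot A (U *m A).
  rewrite /mat_dot conjT trmx_mul mulmxA; congr (\tr (_ *m _ *m _)).
  by rewrite map_trmx; exact: hU.
have : complex.Im (mat_dot (U *m A) A) = - complex.Im (mat_dot (U *m A) A).
  by rewrite {1}e mat_dotC Im_conjc.
lra.
Qed.

Lemma Im_mat_dotD A B C : complex.Im (mat_dot (A + B) C) =
  complex.Im (mat_dot A C) + complex.Im (mat_dot B C).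
Proof. by rewrite mat_dotDl raddfD. Qed.

Lemma Im_mat_dotN A C : complex.Im (mat_dot (- A) C) = - complex.Im (mat_dot A C).
Proof. by rewrite -scaleN1r mat_dotZl mulN1r raddfN. Qed.

Lemma Im_mat_dotC A B : complex.Im (mat_dot A B) = - complex.Im (mat_dot B A).
Proof. by rewrite mat_dotC Im_conjc. Qed.

Lemma Im_mat_dotZ_self E A :
  complex.Im (mat_dot (E *: A) A) = complex.Im E * mat_norm A ^+ 2.
Proof.
rewrite mat_dotZl -Re_mat_dot_self; have := Im_mat_dot_self A.
by case: (mat_dot A A) => x y /= ->; case: (E) => a b /=; rewrite mulr0 add0r.
Qed.

(** The Wronskian of v with its adjoint, that is, the probability current through the bond from n to
    n + 1. *)
Definition current v (n : int) : R := complex.Im (mat_dot (v (n + 1)) (v n)).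

(** Pairing the equation with v(n), the hermitian potential contributes a real number and drops out,
    so only Im E acts as a source. *)
Lemma current_eq V v E n : V n \is hermsymmx -> tau V v n = E *: v n ->
  current v n = current v (n - 1) + complex.Im E * mat_norm (v n) ^+ 2.
Proof.
move=> hV eq_v; have e : v (n + 1) = E *: v n + - v (n - 1) + - (V n *m v n).
  by rewrite -eq_v /tau addrAC addrK addrK.
have e2 : current v (n - 1) = complex.Im (mat_dot (v n) (v (n - 1))) by rewrite /current subrK.
rewrite e2 /current e (Im_mat_dotD (E *: v n + - v (n - 1))) (Im_mat_dotD (E *: v n)).
rewrite (Im_mat_dotN (v (n - 1))) (Im_mat_dotN (V n *m v n)) (Im_mat_dot_hermitian (v n) hV).
by rewrite oppr0 addr0 Im_mat_dotZ_self (Im_mat_dotC (v n)) addrC.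
Qed.

Lemma mulr_le_sqrD (x y : R) : x * y <= y ^+ 2 + x ^+ 2.
Proof.
have := sqr_ge0 (x - y); have := sqr_ge0 x; have := sqr_ge0 y; rewrite !expr2.
lra.
Qed.

Lemma subr_telescope (W : zmodType) (a b x y : W) :
  a + x - b = a - (b + y) + (x + y).
Proof. by rewrite opprD [a + (- b - y)]addrA addrACA addNr addr0 addrAC. Qed.

(** Summed over a window, the current balance equates Im E times the mass of u there with a
    difference of end currents. Those are summable for u in l2, hence tend to 0. *)
Lemma not_eigenvalue_nonreal V E : (forall n, V n \is hermsymmx) ->
  complex.Im E != 0 -> ~ point_spectrum V E.
Proof.
move=> hV E0 [u [/l2_bsum[M uM] u0 eq_u]]; case/eqP: u0.
have J n := current_eq (hV n) (f_equal (fun f => f n) eq_u).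
have sumJ N : current u (Posz N - 1) - current u (Negz N) =
    complex.Im E * psum (fun n => mat_norm (u n) ^+ 2) N.
  elim: N => [|N IH]; first by rewrite psum0 mulr0 subrr.
  rewrite psumS mulrDr -IH (_ : Posz N.+1 - 1 = Posz N); last by lia.
  rewrite J [in current u (Negz N)]J (_ : Negz N - 1 = Negz N.+1); last by lia.
  by rewrite mulrDr; exact: subr_telescope.
pose c : R := (L ^ 2)%:R.
have Jle n : `|current u n| <= c ^+ 2 * (mat_norm (u n) ^+ 2 + mat_norm (u (n + 1)) ^+ 2).
  apply: le_trans (Im_le_cnorm _) _; apply: le_trans (cnorm_mat_dot_le _ _) _.
  have h1 := nrm_le_mat_norm (u n); have h2 := nrm_le_mat_norm (u (n + 1)).
  apply: le_trans (ler_pM (nrm_ge0 _) (nrm_ge0 _) h2 h1) _.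
  rewrite -/c mulrACA -expr2 ler_wpM2l ?sqr_ge0 //.
  exact: mulr_le_sqrD.
have Jsum : bsum (fun n => `|current u n|) (c ^+ 2 * (M + M)).
  apply: ler_bsum Jle _; apply: bsumMl; first exact: sqr_ge0.
  exact: bsumD uM (bsum_shift 1 (fun n => sqr_ge0 (mat_norm (u n))) uM).
have [_ c1] := bsum_cvg0 (fun n => normr_ge0 (current u n)) Jsum.
have [c2 _] := bsum_cvg0 (fun n => normr_ge0 (current u (n - 1)))
  (bsum_shift (- 1) (fun n => normr_ge0 (current u n)) Jsum).
apply/funext => n; apply: nrm_eq0; apply/eqP; rewrite eq_le nrm_ge0 andbT.
apply: le_trans (nrm_le_mat_norm _) _.
have : `|complex.Im E| * mat_norm (u n) ^+ 2 <= 0.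
  have c12 : `|current u (Posz k - 1)| + `|current u (Negz k)| @[k --> \oo] --> 0.
    exact: (cvg0D c2 c1).
  have [N nN] := in_window_ex n.
  apply: (cvgr_to_ge c12); near=> k.
  apply: le_trans (ler_normB _ _); rewrite sumJ normrM ler_wpM2l //.
  apply: le_trans (ler_norm _).
  apply: (psum_ge_term (fun n => sqr_ge0 (mat_norm (u n)))); apply: in_windowW nN.
  by near: k; exact: nbhs_infty_ge.
rewrite pmulr_rle0 ?normr_gt0 // => h.
have -> : mat_norm (u n) = 0.
  by apply/eqP; rewrite -sqrf_eq0 eq_le h sqr_ge0.
by rewrite mulr0.
Unshelve. all: by end_near. Qed.

End Current.

Section Uniqueness.
Context {R : realType} {L : nat}.
Implicit Types (W f v F : Seq R L) (E z : Cplx R) (q : int -> R).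

(** The Lippmann-Schwinger equation. Source and potential are left free so that truncations, limits
    and differences of solutions are all instances. *)
Definition sol W f z v := forall n, v n = conv z (fun k => f k - W k *m v k) n.

Lemma bsum_pot W v q Q B : (forall n, nrm (W n) <= q n) -> bsum q Q ->
  (forall n, nrm (v n) <= B) -> bsum (fun n => nrm (W n *m v n)) (B * Q).
Proof.
move=> Wq qQ vB; have B0 : 0 <= B := le_trans (nrm_ge0 _) (vB 0).
apply: ler_bsum (bsumMl B0 qQ) => n; apply: le_trans (ler_nrmM _ _) _.
by rewrite mulrC ler_pM ?nrm_ge0.
Qed.

Lemma sol_tau b W f E z v M : jost b E z ->
  bsum (fun n => nrm (f n - W n *m v n)) M -> sol W f z v ->
  tau W v - E *: v = f.
Proof.
move=> [z0 zE z1 _ nz1] FM hv; apply/funext => n.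
have := conv_eq n z0 nz1 z1 FM; rewrite -!hv zE => h.
have -> : (tau W v - E *: v) n = v (n + 1) + v (n - 1) - E *: v n + W n *m v n.
  by rewrite /tau; rewrite addrAC.
by rewrite h subrK.
Qed.

(** Meant for combinations of Green functions such as g(m + 1 - k) - z g(m - k), which are zero once
    m passes k. *)
Lemma zsum_vanish {T : Type} {D : set_system T} {DF : ProperFilter D}
    (s : T -> int -> Cplx R) (c : R) F M :
  (forall t k, cnorm (s t k) <= c) -> bsum (fun n => nrm (F n)) M ->
  (forall k, \forall t \near D, s t k = 0) ->
  nrm (zsum (fun k => s t k *: F k)) @[t --> D] --> 0.
Proof.
move=> sc FM s0.
have [t _] := filter_ex (filterT : D setT).
have c0 : 0 <= c := le_trans (cnorm_ge0 _) (sc t 0).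
apply: (@zsum_dominated0 _ _ _ _ _ _ (fun k => c * nrm (F k)) (c * M)).
- by move=> {}t k; rewrite nrmZ ler_wpM2r ?nrm_ge0.
- exact: bsumMl.
move=> k; apply/cvgr0Pnorm_le => e e0; apply: filterS (s0 k) => {}t ->.
by rewrite scale0r nrm0 normr0 ltW.
Qed.

Lemma cnormXz z (n : int) : cnorm z = 1 -> cnorm (z ^ n) = 1.
Proof.
by case: n => m z1; rewrite /exprz ?cnormV cnormX z1 expr1n ?invr1.
Qed.

(** Unique continuation: the recurrence determines v(n - 1) from v(n) and v(n + 1). *)
Lemma sol_zero_backward b V E z v M N : jost b E z ->
  bsum (fun n => nrm (0 - V n *m v n)) M -> sol V 0 z v ->
  (forall k : nat, (N <= k)%N -> v (Posz k) = 0) -> v = 0.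
Proof.
move=> jz FM hv v0; have tv n : v (n - 1) = E *: v n - V n *m v n - v (n + 1).
  have := f_equal (fun g : Seq R L => g n) (sol_tau jz FM hv).
  rewrite /tau /= => /eqP; rewrite subr_eq add0r => /eqP e.
  have -> : E *: v n = v (n + 1) + v (n - 1) + V n *m v n by exact: esym.
  by rewrite addrK addrAC subrr add0r.
have h (m : nat) : v (Posz N - Posz m) = 0 /\ v (Posz N - Posz m + 1) = 0.
  elim: m => [|m [IH1 IH2]].
    by rewrite subr0 v0 // (_ : Posz N + 1 = Posz N.+1) ?v0 //; lia.
  have -> : Posz N - Posz m.+1 = Posz N - Posz m - 1 by lia.
  by rewrite tv IH1 IH2 mulmx0 scaler0 !subr0 subrK.
apply/funext => n; have [nN|nN] := boolP (n <= Posz N).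
  have [m ->] : exists m : nat, n = Posz N - Posz m.
    by exists (absz (Posz N - n)); lia.
  by have [] := h m.
have -> : n = Posz (absz n) by lia.
by rewrite v0 //; lia.
Qed.

Section Hermitian.
Variables (V : Seq R L) (Q : R).
Hypothesis hV : forall n, V n \is hermsymmx.
Hypothesis VQ : bsum (fun n => nrm (V n)) Q.

Lemma bsum_sol0 v B : (forall n, nrm (v n) <= B) ->
  bsum (fun n => nrm (0 - V n *m v n)) (B * Q).
Proof.
move=> vB; under eq_fun do rewrite sub0r nrmN.
exact: bsum_pot (fun n => lexx _) VQ vB.
Qed.

Lemma sol_unique_interior b E z v B : jost b E z -> cnorm z < 1 ->
  ~ point_spectrum V E -> (forall n, nrm (v n) <= B) -> sol V 0 z v -> v = 0.
Proof.
move=> jz z1 nE vB hv; apply: contrapT => v0; apply: nE; exists v.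
have FM := bsum_sol0 vB; have [M' vM'] := conv_l1 z1 FM.
split; [|exact/eqP|].
  by apply: bsum_l2 vB _; under eq_fun do rewrite hv; exact: vM'.
by apply/eqP; rewrite -subr_eq0 (sol_tau jz FM hv).
Qed.

Lemma sol_boundary_cvg0 b E z v B : jost b E z -> cnorm z = 1 ->
  (forall n, nrm (v n) <= B) -> sol V 0 z v ->
  nrm (v (Posz k)) @[k --> \oo] --> 0.
Proof.
move=> jz z1 vB hv; have [z0 zE zle _ nz1] := jz.
pose F : Seq R L := fun n => 0 - V n *m v n.
have FM : bsum (fun n => nrm (F n)) (B * Q) := bsum_sol0 vB.
set g := (cnorm (z ^+ 2 - 1))^-1.
have gg n : cnorm (green z n) <= g by exact: cnorm_green_le.
have Im0 : complex.Im E = 0.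
  by rewrite -zE (Im_joukowski z0) z1 expr1n invr1 subrr mul0r.
(* On the circle E is real, so the current has no source and is constant. *)
have Jc n : current v n = current v 0.
  have tv m : tau V v m = E *: v m.
    have /eqP := f_equal (fun g : Seq R L => g m) (sol_tau jz FM hv).
    by rewrite subr_eq add0r => /eqP.
  have st m : current v m = current v (m - 1).
    by rewrite (current_eq (hV m) (tv m)) Im0 mul0r addr0.
  elim: n => [//|m IH|m IH]; first by rewrite st -addn1 PoszD addrK.
  by rewrite -IH [in RHS]st; congr (current v _); lia.
have Iz : complex.Im z != 0.
  apply/eqP => Iz0; case/eqP: nz1; have := cnorm_sqr z.
  rewrite z1 Iz0 expr1n expr0n addr0 => h.
  have -> : z = (complex.Re z)%:C by case: (z) Iz0 => x y /= ->.
  by rewrite -rmorphXn -h.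
have B0 : 0 <= B := le_trans (nrm_ge0 _) (vB 0).
pose S n := mat_norm (v n) ^+ 2.
(* [dp] and [dm] measure the deviation from an outgoing wave, which is multiplied by z at each step
   away from the origin, to the right and to the left respectively. *)
pose dp (n : int) : Mat R L := v (n + 1) - z *: v n.
pose dm (n : int) : Mat R L := v n - z *: v (n + 1).
have s2 x y : cnorm (green z x - z * green z y) <= g + g.
  apply: le_trans (ler_cnormB _ _) _; rewrite cnormM z1 mul1r; exact: lerD.
have dE x y : v x - z *: v y = zsum (fun k => (green z (x - k) - z * green z (y - k)) *: F k).
  rewrite !hv /conv -(zsumZ _ (bsum_green y zle FM)).
  rewrite -(zsumB (bsum_green x zle FM) (M' := cnorm z * (g * (B * Q)))); last first.
    exact: (@bsum_scale _ _ (cnorm z) (fun=> z) _ _ (fun=> lexx _) (bsum_green y zle FM)).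
  by congr zsum; apply/funext => k; rewrite scalerBl scalerA.
have dp0 : nrm (dp (Posz k)) @[k --> \oo] --> 0.
  rewrite /dp; under eq_fun do rewrite dE.
  apply: zsum_vanish FM _ => // k; near=> m.
  have km : (absz k <= m)%N by near: m; exact: nbhs_infty_ge.
  rewrite /green (_ : absz (Posz m + 1 - k)%R = (absz (Posz m - k)%R).+1); last by lia.
  by rewrite [z ^+ _.+2]exprS -mulrA subrr.
have dm0 : nrm (dm (Negz k)) @[k --> \oo] --> 0.
  rewrite /dm; under eq_fun do rewrite dE.
  apply: zsum_vanish FM _ => // k; near=> m.
  have km : (absz k <= m)%N by near: m; exact: nbhs_infty_ge.
  rewrite /green (_ : absz (Negz m - k)%R = (absz (Negz m + 1 - k)%R).+1); last by lia.
  by rewrite [z ^+ _.+2]exprS -mulrA subrr.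
have Imv x y : complex.Im (mat_dot (v x) (v y)) =
    complex.Im z * S y + complex.Im (mat_dot (v x - z *: v y) (v y)).
  have e : v x = z *: v y + (v x - z *: v y) by rewrite [RHS]addrC subrK.
  by rewrite {1}e (Im_mat_dotD (z *: v y)) Im_mat_dotZ_self.
have Imle x y : `|complex.Im (mat_dot (v x - z *: v y) (v y))| <= nrm (v x - z *: v y) * B.
  apply: le_trans (Im_le_cnorm _) _; apply: le_trans (cnorm_mat_dot_le _ _) _.
  by rewrite ler_wpM2l ?nrm_ge0.
set J0 := current v 0 in Jc.
(* The outgoing form of [v] makes the current [Im z |v|^2] at +oo and
   [- Im z |v|^2] at -oo, up to o(1). *)
have Jp k : `|J0 - complex.Im z * S (Posz k)| <= nrm (dp (Posz k)) * B.
  rewrite -(Jc (Posz k)) /current Imv.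
  by rewrite addrAC subrr add0r; exact: Imle.
have Jm k : `|J0 + complex.Im z * S (Negz k + 1)| <= nrm (dm (Negz k)) * B.
  rewrite -(Jc (Negz k)) /current Im_mat_dotC -[_ * S _]opprK -opprD normrN.
  by rewrite Imv addrAC subrr add0r; exact: Imle.
have S0 n : 0 <= S n by exact: sqr_ge0.
(* After multiplication by Im z both relations contain the nonnegative quantity (Im z)^2 S, with
   opposite signs: the one at -oo bounds J0 Im z above by o(1), the one at +oo bounds it below. *)
have J00 : J0 * complex.Im z = 0.
  have lim0 (a : nat -> R) : a @ \oo --> 0 -> a k * B * `|complex.Im z| @[k --> \oo] --> 0.
    by move=> a0; apply: cvg0M; exact: cvg0M.
  apply/eqP; rewrite eq_le; apply/andP; split.
    apply: (cvgr_to_ge (lim0 _ dm0)); apply: nearW => k.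
    apply: le_trans (ler_wpM2r (normr_ge0 _) (Jm k)); rewrite -normrM.
    apply: le_trans (ler_norm _); rewrite mulrDl mulrAC -expr2 lerDl.
    by rewrite mulr_ge0 ?sqr_ge0.
  rewrite -oppr_le0.
  apply: (cvgr_to_ge (lim0 _ dp0)); apply: nearW => k.
  apply: le_trans (ler_wpM2r (normr_ge0 _) (Jp k)); rewrite -normrM -normrN.
  apply: le_trans (ler_norm _); rewrite mulrBl opprB mulrAC -expr2 lerDr.
  by rewrite mulr_ge0 ?sqr_ge0.
have {}J00 : J0 = 0 by apply/eqP; move/eqP: J00; rewrite mulf_eq0 (negbTE Iz) orbF.
have Sk : S (Posz k) @[k --> \oo] --> 0.
  have lim0 : nrm (dp (Posz k)) * (B / `|complex.Im z|) @[k --> \oo] --> 0.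
    exact: (cvg0M (B / `|complex.Im z|) dp0).
  apply: (@squeeze_cvgr _ _ _ _ (fun=> 0) _ _ _ 0 (cvg_cst _) lim0).
  apply: nearW => k; rewrite S0 /= mulrA ler_pdivlMr ?normr_gt0 //.
  apply: le_trans (Jp k); rewrite J00 sub0r normrN normrM (ger0_norm (S0 _)).
  by rewrite mulrC.
apply/cvgr0Pnorm_le => e e0; pose c : R := 1 + (L ^ 2)%:R.
have c0 : 0 < c by rewrite ltr_wpDr.
have ec : 0 < (e / c) ^+ 2 by rewrite exprn_gt0 // divr_gt0.
have : \forall k \near \oo, `|S (Posz k)| <= (e / c) ^+ 2 by exact: cvgr0_norm_le.
apply: filterS => k.
rewrite ger0_norm // ler_pXn2r ?nnegrE ?mat_norm_ge0 ?divr_ge0 ?(ltW e0) ?(ltW c0) //.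
rewrite ger0_norm ?nrm_ge0 // ler_pdivlMr // mulrC => h.
apply: le_trans (nrm_le_mat_norm _) _; apply: le_trans h.
by rewrite ler_wpM2r ?mat_norm_ge0 // lerDr.
Unshelve. all: by end_near. Qed.

(* Subtracting the plane wave [z ^ n] times a constant, which vanishes because [v]
   tends to 0 at +oo, kills the terms [k <= n]. *)
Lemma sol_boundary_tail b E z v B : jost b E z -> cnorm z = 1 ->
  (forall n, nrm (v n) <= B) -> sol V 0 z v -> forall n,
  v n = zsum (fun k => (green z (n - k) - z / (z ^+ 2 - 1) * z ^ (n - k)) *:
    (0 - V k *m v k)).
Proof.
move=> jz z1 vB hv; have [z0 zE zle _ nz1] := jz.
pose F : Seq R L := fun n => 0 - V n *m v n.
have FM : bsum (fun n => nrm (F n)) (B * Q) := bsum_sol0 vB.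
set g := (cnorm (z ^+ 2 - 1))^-1; set kap := z / (z ^+ 2 - 1).
have gg n : cnorm (green z n) <= g by exact: cnorm_green_le.
have kg n : cnorm (kap * z ^ n) <= g.
  by rewrite !cnormM cnormXz // z1 mul1r mulr1 cnormV.
pose u n := zsum (fun k => (green z (n - k) - kap * z ^ (n - k)) *: F k).
pose a := zsum (fun k => z ^ (- k) *: F k).
have bk n := bsum_scale (fun k => kg (n - k)) FM.
have vu n : v n - u n = (kap * z ^ n) *: a.
  rewrite /u (_ : (fun k => _) =
    (fun k => green z (n - k) *: F k - (kap * z ^ (n - k)) *: F k)); last first.
    by apply/funext => k; rewrite scalerBl.
  rewrite (zsumB (bsum_green n zle FM) (bk n)) hv opprB [LHS]addrC subrK.
  rewrite /a -(zsumZ _ (M := 1 * (B * Q))); last first.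
    by apply: bsum_scale FM => k; rewrite cnormXz.
  by congr zsum; apply/funext => k; rewrite scalerA -mulrA expfzDr.
have u0 : nrm (u (Posz m)) @[m --> \oo] --> 0.
  apply: (zsum_vanish (c := g + g) _ FM) => [m k|k].
    by apply: le_trans (ler_cnormB _ _) _; apply: lerD.
  near=> m; have km : (absz k <= m)%N by near: m; exact: nbhs_infty_ge.
  have mk : Posz m - k = Posz (absz (Posz m - k)) by lia.
  by rewrite {2}mk /green /kap [z ^+ _.+1]exprS mulrAC subrr.
(* Along the positive axis v - u has the constant size |kap| |a|, because |z| = 1, while v and u
   both tend to 0. *)
have a0 : a = 0.
  have h : nrm (v (Posz m)) + nrm (u (Posz m)) @[m --> \oo] --> 0.
    exact: (cvg0D (sol_boundary_cvg0 jz z1 vB hv) u0).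
  have kap0 : 0 < cnorm kap.
    by rewrite cnorm_gt0 mulf_neq0 // invr_neq0 // subr_eq0.
  apply: nrm_eq0; apply/eqP; rewrite eq_le nrm_ge0 andbT.
  rewrite -(pmulr_rle0 _ kap0); apply: (cvgr_to_ge h); apply: nearW => m.
  apply: le_trans (ler_nrmB _ _).
  by rewrite vu nrmZ cnormM cnormXz // mulr1.
by move=> n; apply/eqP; rewrite -subr_eq0 -/(u n) vu a0 scaler0.
Unshelve. all: by end_near. Qed.

Lemma sol_unique_boundary b E z v B : jost b E z -> cnorm z = 1 ->
  (forall n, nrm (v n) <= B) -> sol V 0 z v -> v = 0.
Proof.
move=> jz z1 vB hv; have [z0 zE zle _ nz1] := jz.
have FM := bsum_sol0 vB.
have rep := sol_boundary_tail jz z1 vB hv.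
set g := (cnorm (z ^+ 2 - 1))^-1; set kap := z / (z ^+ 2 - 1) in rep.
have g0 : 0 < g by rewrite invr_gt0 cnorm_gt0 subr_eq0.
have B0 : 0 <= B := le_trans (nrm_ge0 _) (vB 0).
(* The coefficients in [rep] are at most 2 g, so a tail of V with sum 1 / (4 g) contracts by 1/2. *)
have e0 : 0 < (4 * g)^-1 by rewrite invr_gt0 mulr_gt0.
have [N hN] := bsum_off_window (fun n => nrm_ge0 (V n)) VQ e0.
have half (S : R) : (forall m : nat, (N <= m)%N -> nrm (v (Posz m)) <= S) ->
    forall m : nat, (N <= m)%N -> nrm (v (Posz m)) <= S / 2.
  move=> vS m Nm; have S0 : 0 <= S := le_trans (nrm_ge0 _) (vS m Nm).
  rewrite rep; apply: nrm_zsum_le.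
  have -> : S / 2 = (g + g) * S * (4 * g)^-1 by field; rewrite lt0r_neq0.
  apply: ler_bsum (bsumMl _ hN); last by rewrite mulr_ge0 // addr_ge0 // ltW.
  (* For k <= m the coefficient is zero. The remaining k exceed N, so they see only the tail of V
     and values of v already bounded by S. *)
  move=> k; have [km|mk] := boolP (k <= Posz m).
    have mkE : Posz m - k = Posz (absz (Posz m - k)) by lia.
    rewrite {2}mkE /green /kap [z ^+ _.+1]exprS mulrAC subrr scale0r nrm0.
    by case: ifP => _; rewrite !mulr_ge0 ?addr_ge0 ?nrm_ge0 // ltW.
  have kE : k = Posz (absz k) by lia.
  have Nk : (N <= absz k)%N by lia.
  have -> : in_window N k = false by rewrite kE /= ltnNge Nk.
  have vkS : nrm (v k) <= S by rewrite kE vS.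
  rewrite nrmZ -[leRHS]mulrA ler_pM ?nrm_ge0 ?cnorm_ge0 //.
    apply: le_trans (ler_cnormB _ _) _; apply: lerD; first exact: cnorm_green_le.
    by rewrite !cnormM cnormXz // z1 mul1r mulr1 cnormV.
  rewrite sub0r nrmN; apply: le_trans (ler_nrmM _ _) _.
  by rewrite mulrC ler_wpM2r ?nrm_ge0.
have iter j m : (N <= m)%N -> nrm (v (Posz m)) <= B / 2 ^+ j.
  elim: j m => [|j IH] m Nm; first by rewrite expr0 divr1.
  by have := half _ IH m Nm; rewrite exprSr invfM mulrA.
apply: (sol_zero_backward (N := N) jz FM hv) => m Nm.
apply: nrm_eq0; apply/eqP; apply: contraT => v0.
have vp : 0 < nrm (v (Posz m)) by rewrite lt_def v0 nrm_ge0.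
have := Num.Theory.archi_boundP (divr_ge0 B0 (ltW vp)).
set j := Num.bound _ => hj.
have := iter j m Nm; rewrite ler_pdivlMr ?exprn_gt0 // leNgt => /negP[].
rewrite mulrC -ltr_pdivrMr //; apply: lt_le_trans hj _.
by rewrite -natrX ler_nat ltnW // ltn_expl.
Qed.

Lemma sol_unique b E z v B : jost b E z -> ~ point_spectrum V E ->
  (forall n, nrm (v n) <= B) -> sol V 0 z v -> v = 0.
Proof.
move=> jz nE vB hv; have [_ _ zle _ _] := jz.
move: zle; rewrite le_eqVlt => /predU1P[z1|z1].
  exact: sol_unique_boundary jz z1 vB hv.
exact: sol_unique_interior jz z1 nE vB hv.
Qed.

End Hermitian.
End Uniqueness.

(** * A priori bound and existence *)

Section FiniteRank.
Context {R : realType} {L : nat}.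
Implicit Types (W f v F : Seq R L) (z : Cplx R).

Lemma endo_inj_surj (K : fieldType) (vT : vectType K) (phi : {linear vT -> vT}) :
  (forall x, phi x = 0 -> x = 0) -> forall y, exists x, phi x = y.
Proof.
move=> inj y; pose h := linfun phi.
have ker0 : lker h == 0%VS.
  apply/lker0P => x1 x2; rewrite !lfunE => e; apply/eqP; rewrite -subr_eq0.
  by apply/eqP/inj; rewrite linearB e subrr.
have im : limg h = fullv.
  have cap0 : (fullv :&: lker h = 0)%VS by rewrite (eqP ker0) capv0.
  by apply/eqP; rewrite eqEdim subvf (limg_dim_eq cap0) /=.
have : y \in limg h by rewrite im memvf.
by move=> /memv_imgP[x _ ->]; exists x; rewrite lfunE.
Qed.

Definition window_dec N (p : bool * 'I_N) : int :=
  if p.1 then Posz p.2 else Negz p.2.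

Lemma conv_window z F N n : (forall k, ~~ in_window N k -> F k = 0) ->
  conv z F n = \sum_(p : bool * 'I_N) green z (n - window_dec p) *: F (window_dec p).
Proof.
move=> F0; rewrite /conv (@zsum_fin _ _ _ N) ?psum_windowE // => k /F0 ->.
by rewrite scaler0.
Qed.

(** The operator 1 + g_z * W compressed to the window. *)
Definition window_op W z N (x : {ffun bool * 'I_N -> Mat R L}) :
    {ffun bool * 'I_N -> Mat R L} :=
  [ffun p => x p + \sum_q green z (window_dec p - window_dec q) *: (W (window_dec q) *m x q)].

Lemma window_op_linear W z N : linear (@window_op W z N).
Proof.
move=> a x y; apply/ffunP => p; rewrite !ffunE scalerDr addrACA; congr (_ + _).
rewrite scaler_sumr -big_split /=; apply: eq_bigr => q _.
by rewrite !ffunE mulmxDr scalerDr -scalemxAr !scalerA mulrC.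
Qed.

HB.instance Definition _ W z N := GRing.isLinear.Build (Cplx R)
  {ffun bool * 'I_N -> Mat R L} {ffun bool * 'I_N -> Mat R L} _
  (@window_op W z N) (@window_op_linear W z N).

(** W v depends only on the values of v in the window. The equation is therefore a finite square
    system there, and its solution is extended to all sites by the equation itself. *)
Lemma window_solve W z f M N : cnorm z <= 1 ->
  (forall n, ~~ in_window N n -> W n = 0) ->
  (forall v B, (forall n, nrm (v n) <= B) -> sol W 0 z v -> v = 0) ->
  bsum (fun n => nrm (f n)) M ->
  exists v B, (forall n, nrm (v n) <= B) /\ sol W f z v.
Proof.
move=> z1 W0 uniq fM.
pose ext (g : Seq R L) (x : {ffun bool * 'I_N -> Mat R L}) : Seq R L := fun n =>
  g n - \sum_q green z (n - window_dec q) *: (W (window_dec q) *m x q).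
pose G := (cnorm (z ^+ 2 - 1))^-1.
have G0 : 0 <= G by rewrite invr_ge0 cnorm_ge0.
have ext_bound g x B : (forall n, nrm (g n) <= B) ->
    exists B', forall n, nrm (ext g x n) <= B'.
  move=> gB; exists (B + \sum_q G * nrm (W (window_dec q) *m x q)) => n.
  apply: le_trans (ler_nrmB _ _) _; apply: lerD => //.
  apply: le_trans (ler_nrm_sum _ _ _) _; apply: ler_sum => q _.
  by rewrite nrmZ ler_wpM2r ?nrm_ge0 // cnorm_green_le.
have WF v : forall k, ~~ in_window N k -> W k *m v k = 0.
  by move=> k /W0 ->; rewrite mul0mx.
have ext_sol g h Mh x : bsum (fun n => nrm (h n)) Mh -> (forall n, g n = conv z h n) ->
    (forall p, window_op W z x p = g (window_dec p)) -> sol W h z (ext g x).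
  move=> hM gh xg n.
  have xe p : ext g x (window_dec p) = x p.
    by rewrite /ext -xg ffunE addrK.
  have [B vB] := ext_bound g x (G * Mh)
    (fun n => eq_ind_r (fun t => nrm t <= _) (nrm_conv_le n z1 hM) (gh n)).
  have Wv : bsum (fun n => nrm (W n *m ext g x n)) (psum (fun n => nrm (W n *m ext g x n)) N).
    move=> N'; apply: le_trans (psum_homo (fun n => nrm_ge0 _) (leq_maxl N' N)) _.
    by rewrite (@psum_stable _ _ N) ?leq_maxr // => k /WF ->; exact: nrm0.
  rewrite (convB z1 hM Wv) -gh {1}/ext; congr (_ - _).
  rewrite (conv_window _ _ (WF _)); apply: eq_bigr => q _.
  by rewrite xe.
(* A kernel vector extends to a bounded solution with zero source, so the extension vanishes. Read
   at the sites of the window this kills the sum in [window_op], and then x itself. *)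
have inj (x : {ffun bool * 'I_N -> Mat R L}) : window_op W z x = 0 -> x = 0.
  move=> x0; have b0 : bsum (fun n => nrm ((0 : Seq R L) n)) 0.
    by move=> K; rewrite /psum big1 // => k _; rewrite /= !nrm0 addr0.
  have c0 n : (0 : Seq R L) n = conv z 0 n.
    by rewrite /conv (@zsum_fin _ _ _ 0) ?psum0 // => k _; rewrite scaler0.
  have s0 : sol W 0 z (ext 0 x).
    by apply: (ext_sol _ _ 0 _ b0 c0) => p; rewrite x0 ffunE.
  have [B vB] := ext_bound 0 x 0 (fun n => eq_ind_r (fun t => t <= _) (lexx _) nrm0).
  have e0 := uniq _ _ vB s0.
  apply/ffunP => p; rewrite ffunE; have := f_equal (fun g : Seq R L => g (window_dec p)) e0.
  rewrite /ext sub0r => /eqP; rewrite oppr_eq0 => /eqP h.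
  by have := f_equal (fun g : {ffun _ -> _} => g p) x0; rewrite !ffunE h addr0.
have [x xE] := endo_inj_surj inj [ffun p => conv z f (window_dec p)].
have [B vB] := ext_bound (conv z f) x _ (fun n => nrm_conv_le n z1 fM).
exists (ext (conv z f) x), B; split=> //; apply: (ext_sol _ _ _ _ fM) => // p.
exact: etrans (f_equal (fun g : {ffun bool * 'I_N -> Mat R L} => g p) xE) (ffunE _ _).
Qed.

End FiniteRank.

(** * Stability of the equation under pointwise limits *)

Section Limits.
Context {R : realType} {L : nat}.
Implicit Types (V W f v F : Seq R L) (E z : Cplx R) (d B Q : R).

Lemma green_cvg {T : Type} {U : set_system T} {FU : Filter U} (zs : T -> Cplx R) z d m :
  0 < d -> (forall t, cnorm (zs t) <= 1) -> cnorm z <= 1 ->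
  (forall t, d <= cnorm (zs t ^+ 2 - 1)) -> d <= cnorm (z ^+ 2 - 1) ->
  cnorm (zs t - z) @[t --> U] --> 0 ->
  cnorm (green (zs t) m - green z m) @[t --> U] --> 0.
Proof.
move=> d0 zs1 z1 dzs dz zz.
pose C := (1 + `|m|%N%:R) * (2 / d + 4 / d ^+ 2).
apply: (cvg0_le _ (cvg0M C zz)).
apply: nearW => t; rewrite cnorm_ge0 /=.
have := @green_hoelder R (zs t) z d 1 m _ d0 (zs1 t) z1 (dzs t) dz.
by rewrite ltr01 lexx !powRr1 ?cnorm_ge0 ?addr_ge0 // => /(_ isT); rewrite mulrC -mulrA.
Qed.

(** Dominated convergence with a multiple of |V| as majorant. Convergence of the free terms is an
    assumption, so that the result covers both sources tending to 0 and a fixed source. *)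
Lemma sol_limit {T : Type} {U : set_system T} {FU : ProperFilter U}
    (Ws fs vs : T -> Seq R L) (zs : T -> Cplx R) V f v z d B Q (Ms : T -> R) M :
  0 < d -> (forall t, cnorm (zs t) <= 1) -> cnorm z <= 1 ->
  (forall t, d <= cnorm (zs t ^+ 2 - 1)) -> d <= cnorm (z ^+ 2 - 1) ->
  cnorm (zs t - z) @[t --> U] --> 0 ->
  bsum (fun n => nrm (V n)) Q -> (forall t n, nrm (Ws t n) <= nrm (V n)) ->
  (forall n, \forall t \near U, Ws t n = V n) ->
  (forall t n, nrm (vs t n) <= B) -> (forall n, nrm (v n) <= B) ->
  (forall n, nrm (vs t n - v n) @[t --> U] --> 0) ->
  (forall t, bsum (fun n => nrm (fs t n)) (Ms t)) -> bsum (fun n => nrm (f n)) M ->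
  (forall n, nrm (conv (zs t) (fs t) n - conv z f n) @[t --> U] --> 0) ->
  (forall t, sol (Ws t) (fs t) (zs t) (vs t)) -> sol V f z v.
Proof.
move=> d0 zs1 z1 dzs dz zz VQ WV Weq vsB vB vsv fsM fM cf hs n.
have gz m : cnorm (green z m) <= d^-1.
  by apply: le_trans (cnorm_green_le m z1) _; rewrite lef_pV2 ?posrE // (lt_le_trans d0).
have gzs t m : cnorm (green (zs t) m) <= d^-1.
  apply: le_trans (cnorm_green_le m (zs1 t)) _.
  by rewrite lef_pV2 ?posrE // (lt_le_trans d0).
have bWs t := bsum_pot (WV t) VQ (vsB t).
have bV := bsum_pot (fun n => lexx _) VQ vB.
have B0 : 0 <= B := le_trans (nrm_ge0 _) (vB 0).
have di0 : 0 <= d^-1 by rewrite invr_ge0 ltW.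
rewrite (convB z1 fM bV).
apply: nrm_lim_unique (vsv n) _.
pose h t k := green (zs t) (n - k) *: (Ws t k *m vs t k) - green z (n - k) *: (V k *m v k).
have h0 : nrm (zsum (h t)) @[t --> U] --> 0.
  apply: (@zsum_dominated0 _ _ _ _ _ _
    (fun k => (d^-1 * B + d^-1 * B) * nrm (V k)) ((d^-1 * B + d^-1 * B) * Q)).
  - move=> t k; rewrite mulrDl -!mulrA; apply: le_trans (ler_nrmB _ _) _; apply: lerD.
      rewrite nrmZ; apply: ler_pM; rewrite ?cnorm_ge0 ?nrm_ge0 //.
      by apply: le_trans (ler_nrmM _ _) _; rewrite mulrC; apply: ler_pM; rewrite ?nrm_ge0.
    rewrite nrmZ; apply: ler_pM; rewrite ?cnorm_ge0 ?nrm_ge0 //.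
    by apply: le_trans (ler_nrmM _ _) _; rewrite mulrC; apply: ler_pM; rewrite ?nrm_ge0.
  - by apply: bsumMl => //; rewrite addr_ge0 // mulr_ge0.
  move=> k.
  apply: (cvg0_le _ (cvg0D (cvg0M (nrm (V k) * B) (green_cvg (n - k) d0 zs1 z1 dzs dz zz))
     (cvg0M (d^-1 * nrm (V k)) (vsv k)))).
  apply: filterS (Weq k) => t Wt; rewrite nrm_ge0 /= /h Wt.
  have -> : green (zs t) (n - k) *: (V k *m vs t k) - green z (n - k) *: (V k *m v k) =
    (green (zs t) (n - k) - green z (n - k)) *: (V k *m vs t k) +
    green z (n - k) *: (V k *m (vs t k - v k)).
    by rewrite scalerBl mulmxBr scalerBr addrA subrK.
  apply: le_trans (ler_nrmD _ _) _; rewrite !nrmZ; apply: lerD.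
    rewrite ler_wpM2l ?cnorm_ge0 //; apply: le_trans (ler_nrmM _ _) _.
    by rewrite ler_wpM2l ?nrm_ge0.
  rewrite [leRHS]mulrCA; apply: ler_pM; rewrite ?cnorm_ge0 ?nrm_ge0 //.
  by rewrite [leRHS]mulrC ler_nrmM.
apply: (cvg0_le _ (cvg0D (cf n) h0)).
apply: nearW => t; rewrite nrm_ge0 /= hs (convB (zs1 t) (fsM t) (bWs t)).
have -> : zsum (h t) =
    conv (zs t) (fun k => Ws t k *m vs t k) n - conv z (fun k => V k *m v k) n.
  by rewrite /conv -(zsumB (bsum_green n (zs1 t) (bWs t)) (bsum_green n z1 bV)).
have subACA (A B' C D : Mat R L) : A - B' - (C - D) = A - C - (B' - D).
  by rewrite opprD addrACA -opprD.
by rewrite subACA; exact: ler_nrmB.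
Qed.

End Limits.

Section APriori.
Context {R : realType} {L : nat}.
Implicit Types (W f v F : Seq R L) (E z : Cplx R) (K : set (Cplx R)).

Definition limiting_set (b : bool) (V : Seq R L) : set (Cplx R) :=
  [set E | [/\ 0 <= (-1) ^+ b * complex.Im E, E != 2, E != -2 &
            ~ point_spectrum V E]].

Lemma compact_ultra_seq K (e : nat -> Cplx R) : compact K -> (forall j, K (e j)) ->
  exists2 U : set_system nat, UltraFilter U /\ \oo `<=` U &
  exists2 E, K E & cnorm (e j - E) @[j --> U] --> 0.
Proof.
move=> cK Ke; have [U [uU sU]] := ultraFilterLemma (_ : ProperFilter \oo).
exists U => //; have [E KE eE] := @ultra_compact_cvg _ _ U uU e K cK Ke.
by exists E => //; apply/cvg_cnorm.
Qed.

Lemma ultra_near_ge {U : set_system nat} (m : nat) : \oo `<=` U ->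
  \forall j \near U, (m <= j)%N.
Proof. by apply; exact: nbhs_infty_ge. Qed.

Lemma compact_cnorm_bounded K : compact K -> exists B : R, forall E, K E -> cnorm E <= B.
Proof.
move=> cK; apply: contrapT => /forallNP h.
have {h} /choice[e he] j : exists E, K E /\ ~ cnorm E <= j%:R.
  have /existsNP[E /not_implyP hE] := h j%:R; by exists E.
have [U [uU sU] [E KE eE]] := compact_ultra_seq cK (fun j => (he j).1).
have near1 : \forall j \near U, `|cnorm (e j - E)| <= 1 by apply: cvgr0_norm_le.
have near2 := ultra_near_ge (Num.bound (cnorm E + 1)) sU.
have [j [h1 h2]] := filter_ex (filterI near1 near2).
case: (he j) => _; apply; rewrite -[e j](subrK E).
apply: le_trans (ler_cnormD _ _) _; rewrite ger0_norm ?cnorm_ge0 // in h1.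
apply: (@le_trans _ _ (cnorm E + 1)); first by rewrite addrC lerD2l.
apply: ltW; apply: lt_le_trans (archi_boundP _) _; first by rewrite addr_ge0 ?cnorm_ge0.
by rewrite ler_nat.
Qed.

Lemma compact_cnorm_away K (E0 : Cplx R) : compact K -> (forall E, K E -> E != E0) ->
  exists2 d : R, 0 < d & forall E, K E -> d <= cnorm (E - E0).
Proof.
move=> cK KE0; apply: contrapT => h.
have /choice[e he] (j : nat) : exists E, K E /\ cnorm (E - E0) < j.+1%:R^-1.
  apply: contrapT => /forallNP hj; apply: h; exists j.+1%:R^-1 => // E KE.
  by rewrite leNgt; apply/negP => hlt; apply: (hj E).
have [U [uU sU] [E KE eE]] := compact_ultra_seq cK (fun j => (he j).1).
have E0E := KE0 _ KE; have pos : 0 < cnorm (E - E0) / 2.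
  by rewrite divr_gt0 // cnorm_gt0 subr_eq0.
have near1 : \forall j \near U, `|cnorm (e j - E)| <= cnorm (E - E0) / 2.
  by apply: cvgr0_norm_le.
have near2 := ultra_near_ge (Num.bound (cnorm (E - E0) / 2)^-1) sU.
have [j [h1 h2]] := filter_ex (filterI near1 near2).
have h3 : cnorm (e j - E0) < cnorm (E - E0) / 2.
  apply: lt_le_trans (he j).2 _; rewrite -[leRHS]invrK lef_pV2 ?posrE ?invr_gt0 //.
  apply: ltW; apply: lt_le_trans (archi_boundP _) _; first by rewrite invr_ge0 ltW.
  by rewrite ler_nat ltnW // ltnS.
rewrite ger0_norm ?cnorm_ge0 // cnormBC in h1.
have : cnorm (E - E0) <= cnorm (E - e j) + cnorm (e j - E0).
  by apply: le_trans (ler_cnormD _ _); rewrite addrA subrK.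
lra.
Qed.

Lemma jost_compact (b : bool) V K : compact K -> K `<=` limiting_set b V ->
  exists2 d : R, 0 < d & forall E z, K E -> jost b E z ->
  [/\ d <= cnorm (z - 1) ^+ 2, d <= cnorm (z + 1) ^+ 2 & d <= cnorm (z ^+ 2 - 1)].
Proof.
move=> cK KG; have [B hB] := compact_cnorm_bounded cK.
have [d1 d10 h1] : exists2 d : R, 0 < d & forall E, K E -> d <= cnorm (E - 2).
  by apply: compact_cnorm_away cK _ => E /KG[].
have [d2 d20 h2] : exists2 d : R, 0 < d & forall E, K E -> d <= cnorm (E - (-2)).
  by apply: compact_cnorm_away cK _ => E /KG[].
have [K0|/set0P[E0 KE0]] := eqVneq K set0.
  by exists 1 => // E z; rewrite K0.
have B0 : 0 <= B := le_trans (cnorm_ge0 _) (hB _ KE0).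
exists (Num.min d1 d2 / (B + 1)).
  by rewrite divr_gt0 ?lt_min ?d10 ?d20 // ltr_wpDl.
move=> E z KE jz; apply: jost_away jz (hB _ KE) _ _ _.
- by rewrite ge_min h1.
- by have := h2 _ KE; rewrite opprK ge_min => ->; rewrite orbT.
- by rewrite le_min !ltW.
Qed.

Section Potential.
Variables (b : bool) (V : Seq R L) (Q : R).
Hypothesis hV : forall n, V n \is hermsymmx.
Hypothesis VQ : bsum (fun n => nrm (V n)) Q.

(** The values of W outside the window are free to be those of V or 0, site by site, so the class
    contains V itself and every truncation to a larger window. *)
Definition truncates (N : nat) W : Prop :=
  forall n, W n = V n \/ (W n = 0 /\ ~~ in_window N n).

Lemma truncates_nrm N W n : truncates N W -> nrm (W n) <= nrm (V n).
Proof. by move=> /(_ n)[->//|[-> _]]; rewrite nrm0 nrm_ge0. Qed.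

Lemma truncates_near {U : set_system nat} {FU : Filter U} (Ws : nat -> Seq R L) n :
  \oo `<=` U -> (forall j, truncates j (Ws j)) -> \forall j \near U, Ws j n = V n.
Proof.
move=> sU hW; have [N nN] := in_window_ex n.
apply: filterS (ultra_near_ge N sU) => j Nj.
by case: (hW j n) => // -[_]; rewrite (in_windowW Nj nN).
Qed.

(* Dividing by [sup |v|] turns a failure of the bound with constant [c] into a
   solution of norm 1 with source of norm at most [1 / c]. *)
Lemma normalized_violation E z W f v M B (c : R) : jost b E z ->
  bsum (fun n => nrm (f n)) M -> (forall n, nrm (v n) <= B) -> sol W f z v ->
  (forall n, nrm (W n) <= nrm (V n)) -> 0 < c ->
  (exists n, ~ nrm (v n) <= c * M) ->
  exists f' v', [/\ bsum (fun n => nrm (f' n)) c^-1, forall n, nrm (v' n) <= 1,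
    exists n, 2^-1 <= nrm (v' n) & sol W f' z v'].
Proof.
move=> [_ _ z1 _ _] fM vB hv WV c0 [n0 /negP]; rewrite -ltNge => hn0.
have M0 := bsum_ge0 fM.
have hs : has_sup (range (fun n => nrm (v n))).
  by split; [exists (nrm (v 0)), 0|exists B => _ [n _ <-]].
set S := sup (range (fun n => nrm (v n))).
have vS n : nrm (v n) <= S by apply: sup_upper_bound hs _ _; exists n.
have cMS : c * M < S := lt_le_trans hn0 (vS n0).
have S0 : 0 < S by apply: le_lt_trans cMS; rewrite mulr_ge0 // ltW.
have cS : cnorm (S^-1)%:C = S^-1.
  by rewrite /= expr0n addr0 sqrtr_sqr ger0_norm // invr_ge0 ltW.
exists (fun n => (S^-1)%:C *: f n), (fun n => (S^-1)%:C *: v n); split.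
- have h : S^-1 * M <= c^-1.
    by rewrite -(ler_pM2l S0) mulrA mulfV ?lt0r_neq0 // mul1r ler_pdivlMr // mulrC ltW.
  move=> N; apply: le_trans h.
  have Si : 0 <= S^-1 by rewrite invr_ge0 ltW.
  rewrite (eq_psum (g := fun n => S^-1 * nrm (f n))) => [|n _]; first exact: (bsumMl Si fM).
  by rewrite nrmZ cS.
- by move=> n; rewrite nrmZ cS mulrC ler_pdivrMr // mul1r.
(* The supremum need not be attained, hence the lower bound 1/2 instead of 1. *)
- have S2 : 0 < S / 2 by exact: divr_gt0.
  have [_ [n _ <-] hn] := sup_adherent S2 hs.
  exists n; rewrite nrmZ cS mulrC ler_pdivlMr //; rewrite -/S in hn.
  by apply: ltW; apply: le_lt_trans hn; lra.
- move=> n; rewrite hv.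
  have bW := bsum_pot WV VQ vB.
  rewrite -[RHS]/(conv z (fun k => (S^-1)%:C *: f k - W k *m ((S^-1)%:C *: v k)) n).
  have -> : (fun k => (S^-1)%:C *: f k - W k *m ((S^-1)%:C *: v k)) =
    (fun k => (S^-1)%:C *: (f k - W k *m v k)).
    by apply/funext => k; rewrite scalerBr scalemxAr.
  by rewrite (convZ _ z1 (bsum_nrmB fM bW)).
Qed.

Lemma apriori K : compact K -> K `<=` limiting_set b V ->
  exists (C : R) (N : nat), 0 < C /\ forall E z W f v M B, K E -> jost b E z ->
    truncates N W -> bsum (fun n => nrm (f n)) M -> (forall n, nrm (v n) <= B) ->
    sol W f z v -> forall n, nrm (v n) <= C * M.
Proof.
move=> cK KG; have [d d0 hd] := jost_compact cK KG.
apply: contrapT => hno.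
(* The constant [j.+1] and the window [j] are refuted together: along the sequence the sources tend
   to 0 and the potentials tend to V. *)
have /choice[p hp] (j : nat) : exists p : Cplx R * Cplx R * (Seq R L * Seq R L * Seq R L),
    let: (E, z, (W, f, v)) := p in
    [/\ K E /\ jost b E z, truncates j W, bsum (fun n => nrm (f n)) j.+1%:R^-1,
     (forall n, nrm (v n) <= 1) & (exists n, 2^-1 <= nrm (v n)) /\ sol W f z v].
  apply: contrapT => hj; apply: hno; exists j.+1%:R, j; split=> //.
  move=> E z W f v M B KE jz hW fM vB hv n; apply: contrapT => hn; apply: hj.
  have [f' [v' [h1 h2 h3 h4]]] := normalized_violation jz fM vB hv
    (fun n => truncates_nrm n hW) (ltr0Sn _ j) (ex_intro _ n hn).
  by exists (E, z, (W, f', v')).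
pose Es j := (p j).1.1; pose zs j := (p j).1.2; pose Ws j := (p j).2.1.1.
pose fs j := (p j).2.1.2; pose vs j := (p j).2.2.
have {}hp j : [/\ K (Es j) /\ jost b (Es j) (zs j), truncates j (Ws j),
    bsum (fun n => nrm (fs j n)) j.+1%:R^-1, (forall n, nrm (vs j n) <= 1) &
    (exists n, 2^-1 <= nrm (vs j n)) /\ sol (Ws j) (fs j) (zs j) (vs j)].
  by have := hp j; rewrite /Es /zs /Ws /fs /vs; case: (p j) => -[E z] [[W f] v].
have KEs j : K (Es j) by have [[]] := hp j.
have jzs j : jost b (Es j) (zs j) by have [[]] := hp j.
have hWs j : truncates j (Ws j) by have [] := hp j.
have bfs j : bsum (fun n => nrm (fs j n)) j.+1%:R^-1 by have [] := hp j.
have vs1 j n : nrm (vs j n) <= 1 by have [] := hp j.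
have vs2 j : exists n, 2^-1 <= nrm (vs j n) by have [_ _ _ _ []] := hp j.
have hs j : sol (Ws j) (fs j) (zs j) (vs j) by have [_ _ _ _ []] := hp j.
have [U [uU sU] [E KE EsE]] := compact_ultra_seq cK KEs.
have [sE E2 E2' nE] := KG _ KE.
have [z jz] := jost_exists sE E2 E2'.
have dz := hd _ _ KE jz; have dzs j := hd _ _ (KEs j) (jzs j).
have z1 : cnorm z <= 1 by case: jz.
have zs1 j : cnorm (zs j) <= 1 by case: (jzs j).
have zsz : cnorm (zs j - z) @[j --> U] --> 0.
  apply: (cvg0_le _ (cvg0M (2 / d) EsE)); apply: nearW => j.
  rewrite cnorm_ge0 /= mulrC; have [h1 h2 _] := dzs j.
  exact: jost_lipschitz (jzs j) jz d0 h1 h2.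
have /choice[v vsv] n : exists A, nrm (vs j n - A) @[j --> U] --> 0.
  exact: (@ultra_nrm_lim _ _ _ _ uU (fun j => vs j n) 1 (fun j => vs1 j n)).
have vb n : nrm (v n) <= 1.
  have h : nrm (vs j n - v n) + 1 @[j --> U] --> (0 + 1 : R).
    by apply: cvgD => //; exact: cvg_cst.
  rewrite add0r in h; apply: (cvgr_to_ge h); apply: nearW => j.
  apply: (@le_trans _ _ (nrm (vs j n - v n) + nrm (vs j n))); last by rewrite lerD2l.
  by rewrite nrmBC; apply: le_trans (ler_nrmD _ _); rewrite subrK.
have inv0 : j.+1%:R^-1 @[j --> U] --> (0 : R).
  by move=> A /(@cvg_harmonic R) hA; exact: sU hA.
have b0 : bsum (fun n => nrm ((0 : Seq R L) n)) 0.
  by move=> N; rewrite /psum big1 // => k _; rewrite /= !nrm0 addr0.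
have c0 n : conv z (0 : Seq R L) n = 0.
  by rewrite /conv (@zsum_fin _ _ _ 0) ?psum0 // => k _; rewrite scaler0.
have gle j : (cnorm (zs j ^+ 2 - 1))^-1 <= d^-1.
  have [_ _ h] := dzs j; rewrite lef_pV2 ?posrE //; exact: lt_le_trans h.
have hv : sol V 0 z v.
  have dzs3 j : d <= cnorm (zs j ^+ 2 - 1) by have [] := dzs j.
  have dz3 : d <= cnorm (z ^+ 2 - 1) by have [] := dz.
  apply: (sol_limit d0 zs1 z1 dzs3 dz3 zsz VQ
    (fun j n => truncates_nrm n (hWs j)) (fun n => truncates_near n sU hWs)
    vs1 vb vsv bfs b0 _ hs).
  move=> n; apply: (cvg0_le _ (cvg0M d^-1 inv0)); apply: nearW => j.
  rewrite nrm_ge0 c0 subr0 /= mulrC; apply: le_trans (nrm_conv_le n (zs1 j) (bfs j)) _.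
  by rewrite ler_wpM2r ?invr_ge0.
have v0 := sol_unique hV VQ jz nE vb hv.
(* Pointwise convergence of [vs] to 0 does not contradict the lower bound 1/2, whose site may escape
   to infinity. Multiplying by V makes the convergence summable. *)
have lim0 n : nrm (V n) * nrm (vs j n) @[j --> U] --> 0.
  have h : nrm (vs j n) * nrm (V n) @[j --> U] --> 0.
    apply: cvg0M; have := vsv n; rewrite v0.
    by under eq_fun do rewrite subr0.
  by under eq_fun do rewrite mulrC.
(* Source and potential term each get d/8; as the Green function is at most 1/d, this gives |v| <=
   1/4 at a site where |v| >= 1/2. *)
have e0 : 0 < d / 8 by rewrite divr_gt0.
have near1 : \forall j \near U, bsum (fun n => nrm (V n) * nrm (vs j n)) (d / 8).
  apply: (dominated_bsum _ _ VQ lim0 e0) => j n; first by rewrite mulr_ge0 ?nrm_ge0.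
  by rewrite ler_piMr ?nrm_ge0.
have near2 : \forall j \near U, `|(j.+1%:R^-1 : R)| <= d / 8 by apply: cvgr0_norm_le.
have [j [h1 h2]] := filter_ex (filterI near1 near2).
have [n hn] := vs2 j.
have : nrm (vs j n) <= d^-1 * (d / 8 + d / 8).
  rewrite hs; apply: le_trans (nrm_conv_le n (zs1 j)
    (bsum_nrmB (bfs j) (_ : bsum _ (d / 8)))) _.
    apply: ler_bsum h1 => k; apply: le_trans (ler_nrmM _ _) _.
    by rewrite ler_wpM2r ?nrm_ge0 // (truncates_nrm _ (hWs j)).
  apply: ler_pM => //; rewrite ?invr_ge0 ?cnorm_ge0 ?addr_ge0 ?invr_ge0 ?(ltW e0) //.
  by rewrite lerD2r; apply: le_trans (ler_norm _) h2.
have -> : d^-1 * (d / 8 + d / 8) = 4^-1 by field; rewrite lt0r_neq0.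
lra.
Qed.

End Potential.
End APriori.

(** * Hoelder continuity of the solutions *)

Section Weights.
Context {R : realType}.
Implicit Types (beta : R) (n k : int).

Definition wt beta n : R := (1 + `|n|%N%:R) `^ beta.

Lemma wt_base_ge1 n : 1 <= 1 + `|n|%N%:R :> R.
Proof. by rewrite lerDl. Qed.

Lemma wt_ge0 beta n : 0 <= wt beta n.
Proof. exact: powR_ge0. Qed.

Lemma wt_ge1 beta n : 0 <= beta -> 1 <= wt beta n.
Proof.
move=> b0; have := @ge0_ler_powR R beta b0 1 (1 + `|n|%N%:R).
rewrite powR1 !nnegrE => ->//; exact: wt_base_ge1.
Qed.

Lemma wt_sub beta n k : 0 <= beta -> wt beta (n - k) <= wt beta n * wt beta k.
Proof.
move=> b0; rewrite /wt -powRM ?addr_ge0 //; apply: ge0_ler_powR => //.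
- by rewrite nnegrE addr_ge0.
- by rewrite nnegrE mulr_ge0 ?addr_ge0.
have h : (`|(n - k)%R| <= `|n| + `|k|)%N by lia.
have h' : (absz (n - k))%:R <= (absz n)%:R + (absz k)%:R :> R.
  by rewrite -natrD ler_nat.
have := mulr_ge0 (ler0n R `|n|) (ler0n R `|k|).
by rewrite mulrDl mul1r mulrDr mulr1; lra.
Qed.

Lemma bsum_point (r : int) (c : R) : 0 <= c ->
  bsum (fun k => if k == r then c else 0) c.
Proof.
move=> c0 N; suff -> : psum (fun k => if k == r then c else 0) N =
    if in_window N r then c else 0 by case: ifP.
elim: N => [|N IH]; first by rewrite psum0; case: (r).
rewrite psumS IH; case: r {IH} => k /=.
  rewrite addr0 ltnS (leq_eqVlt k N) [k == N]eq_sym -[Posz N == k]/(N == k).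
  by case: eqP => [->|_] /=; rewrite ?ltnn ?add0r ?addr0.
rewrite add0r ltnS (leq_eqVlt k N) [k == N]eq_sym -[Negz N == Negz k]/(N == k).
by case: eqP => [->|_] /=; rewrite ?ltnn ?add0r ?addr0.
Qed.

End Weights.

Section Solutions.
Context {R : realType} {L : nat}.
Implicit Types (A : Mat R L) (f v F W : Seq R L) (E z : Cplx R) (K : set (Cplx R)).
Variables (b : bool) (V : Seq R L) (beta Q : R).
Hypothesis hV : forall n, V n \is hermsymmx.
Hypothesis hbeta : 0 < beta <= 1.
Hypothesis wVQ : bsum (fun n => wt beta n * nrm (V n)) Q.

Lemma beta_ge0 : 0 <= beta. Proof. by case/andP: hbeta => /ltW. Qed.

Lemma bsum_V : bsum (fun n => nrm (V n)) Q.
Proof.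
by apply: ler_bsum wVQ => n; rewrite ler_peMl ?nrm_ge0 // wt_ge1 ?beta_ge0.
Qed.

Lemma bsum_delta r A : bsum (fun n => nrm (delta_seq r A n)) (nrm A).
Proof.
apply: ler_bsum (bsum_point r (nrm_ge0 A)) => k.
by rewrite /delta_seq; case: eqP => _; rewrite ?nrm0.
Qed.

Lemma bsum_wt_delta r A :
  bsum (fun n => wt beta n * nrm (delta_seq r A n)) (wt beta r * nrm A).
Proof.
have c0 : 0 <= wt beta r * nrm A by rewrite mulr_ge0 ?wt_ge0 ?nrm_ge0.
apply: ler_bsum (bsum_point r c0) => k.
by rewrite /delta_seq; case: eqP => [->//|_]; rewrite nrm0 mulr0.
Qed.

Lemma sol_linear W f f' z v v' (a : Cplx R) M M' B B' QW : cnorm z <= 1 ->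
  bsum (fun n => nrm (W n)) QW ->
  bsum (fun n => nrm (f n)) M -> bsum (fun n => nrm (f' n)) M' ->
  (forall n, nrm (v n) <= B) -> (forall n, nrm (v' n) <= B') ->
  sol W f z v -> sol W f' z v' ->
  sol W (fun n => a *: f n + f' n) z (fun n => a *: v n + v' n).
Proof.
move=> z1 WQ fM fM' vB vB' hv hv' n.
have bF := bsum_nrmB fM (bsum_pot (fun n => lexx _) WQ vB).
have bF' := bsum_nrmB fM' (bsum_pot (fun n => lexx _) WQ vB').
have baF := @bsum_scale _ _ (cnorm a) (fun=> a) _ _ (fun=> lexx _) bF.
rewrite (hv n) (hv' n).
have -> : a *: conv z (fun k => f k - W k *m v k) n =
    conv z (fun k => a *: (f k - W k *m v k)) n by rewrite (convZ a z1 bF).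
have -> : conv z (fun k => a *: (f k - W k *m v k)) n +
    conv z (fun k => f' k - W k *m v' k) n =
    conv z (fun k => a *: (f k - W k *m v k) + (f' k - W k *m v' k)) n.
  by rewrite (convD z1 baF bF').
congr (conv z _ n); apply/funext => k.
by rewrite mulmxDr -scalemxAr scalerBr opprD addrACA.
Qed.

(** With zero source the a priori bound is the uniqueness that the truncated problems require. Being
    uniform in the truncation, it also keeps their solutions bounded in the limit. *)
Lemma sol_exists E z f M : limiting_set b V E -> jost b E z ->
  bsum (fun n => nrm (f n)) M ->
  exists v B, (forall n, nrm (v n) <= B) /\ sol V f z v.
Proof.
move=> hE jz fM; have cE : compact [set E] by exact: compact_set1.
have sE : [set E] `<=` limiting_set b V by move=> _ ->.
have [C [N [C0 hC]]] := apriori hV bsum_V cE sE.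
have [z0 zE z1 _ nz1] := jz.
(* The [N] makes the a priori bound applicable to every truncation, the [j] makes them converge to
   V. *)
pose W j n := if in_window (N + j) n then V n else 0.
have WN j : truncates V N (W j).
  move=> n; rewrite /W; case: ifP => [_|h]; [by left|right; split=> //].
  by apply/negP => /(in_windowW (leq_addr j N)); rewrite h.
have Wj j : truncates V j (W j).
  move=> n; rewrite /W; case: ifP => [_|h]; [by left|right; split=> //].
  by apply/negP => /(in_windowW (leq_addl N j)); rewrite h.
have b0 : bsum (fun n => nrm ((0 : Seq R L) n)) 0.
  by move=> m; rewrite /psum big1 // => k _; rewrite /= !nrm0 addr0.
have /choice[vs hvs] j : exists v, (forall n, nrm (v n) <= C * M) /\ sol (W j) f z v.
  have [|v B vB hv|v [B [vB hv]]] := @window_solve _ _ (W j) z f M (N + j)%N z1 _ _ fM.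
  - by move=> n; rewrite /W => /negbTE ->.
  - apply/funext => n; apply: nrm_eq0; apply/eqP; rewrite eq_le nrm_ge0 andbT.
    by have := hC _ _ _ _ _ _ _ (erefl : [set E] E) jz (WN j) b0 vB hv n; rewrite mulr0.
  - by exists v; split=> //; exact: hC (erefl : [set E] E) jz (WN j) fM vB hv.
have [U [uU sU]] := ultraFilterLemma (_ : ProperFilter \oo).
have /choice[v vsv] n : exists A, nrm (vs j n - A) @[j --> U] --> 0.
  exact: (@ultra_nrm_lim _ _ _ _ uU (fun j => vs j n) (C * M) (fun j => (hvs j).1 n)).
have vb n : nrm (v n) <= C * M.
  have h : nrm (vs j n - v n) + C * M @[j --> U] --> (0 + C * M : R).
    by apply: cvgD; [exact: vsv|exact: cvg_cst].
  rewrite add0r in h; apply: (cvgr_to_ge h); apply: nearW => j.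
  apply: (@le_trans _ _ (nrm (vs j n - v n) + nrm (vs j n))).
    by rewrite nrmBC; apply: le_trans (ler_nrmD _ _); rewrite subrK.
  by rewrite lerD2l; exact: (hvs j).1.
exists v, (C * M); split=> //.
have d0 : 0 < cnorm (z ^+ 2 - 1) by rewrite cnorm_gt0 subr_eq0.
apply: (sol_limit (zs := fun=> z) (Ws := W) (fs := fun=> f) (Ms := fun=> M) d0
  (fun=> z1) z1 (fun=> lexx _) (lexx _) _ bsum_V
  (fun j n => truncates_nrm n (Wj j)) (fun n => truncates_near n sU Wj)
  (fun j => (hvs j).1) vb vsv (fun=> fM) fM _ (fun j => (hvs j).2)).
- by under eq_fun do rewrite subrr cnorm0; exact: cvg_cst.
- by move=> n; under eq_fun do rewrite subrr nrm0; exact: cvg_cst.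
Qed.

Lemma conv_hoelder z z' d F M n : 0 < d -> cnorm z <= 1 -> cnorm z' <= 1 ->
  d <= cnorm (z ^+ 2 - 1) -> d <= cnorm (z' ^+ 2 - 1) ->
  bsum (fun n => wt beta n * nrm (F n)) M ->
  nrm (conv z F n - conv z' F n) <=
    (2 / d + 4 / d ^+ 2) * cnorm (z - z') `^ beta * wt beta n * M.
Proof.
move=> d0 z1 z1' dz dz' FM.
have FM' : bsum (fun n => nrm (F n)) M.
  by apply: ler_bsum FM => k; rewrite ler_peMl ?nrm_ge0 // wt_ge1 ?beta_ge0.
rewrite /conv -(zsumB (bsum_green n z1 FM') (bsum_green n z1' FM')).
set G := 2 / d + 4 / d ^+ 2.
have G0 : 0 <= G by rewrite addr_ge0 // divr_ge0 // ?exprn_ge0 // ltW.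
apply: nrm_zsum_le.
apply: ler_bsum (bsumMl _ FM) => [k|]; last first.
  by rewrite !mulr_ge0 ?powR_ge0 ?wt_ge0.
rewrite -scalerBl nrmZ mulrA ler_wpM2r ?nrm_ge0 //.
apply: le_trans (green_hoelder (n - k) hbeta d0 z1 z1' dz dz') _.
rewrite -/G -!mulrA ler_wpM2l // ler_wpM2l ?powR_ge0 //.
exact: wt_sub beta_ge0.
Qed.

Lemma sol_bound_hoelder K : compact K -> K `<=` limiting_set b V ->
  exists2 C : R, 0 <= C & forall E E' z z' r A v v' B, K E -> K E' ->
    jost b E z -> jost b E' z' ->
    (forall n, nrm (v n) <= B) -> (forall n, nrm (v' n) <= B) ->
    sol V (delta_seq r A) z v -> sol V (delta_seq r A) z' v' ->
    (forall n, nrm (v n) <= C * nrm A) /\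
    (forall n, nrm (v n - v' n) <=
       C * cnorm (E - E') `^ beta * wt beta r * wt beta n * nrm A).
Proof.
move=> cK KG; have [C1 [N [C10 hC]]] := apriori hV bsum_V cK KG.
have [d d0 hd] := jost_compact cK KG.
have Q0 := bsum_ge0 wVQ; have b0 := beta_ge0.
have tV : truncates V N V by move=> n; left.
set G := 2 / d + 4 / d ^+ 2.
have G0 : 0 <= G by rewrite addr_ge0 // divr_ge0 // ?exprn_ge0 // ltW.
set c := 1 + C1 * Q; have c1 : 1 <= c by rewrite lerDl mulr_ge0 // ltW.
have c0 : 0 <= c by lra.
have p0 : 0 <= (2 / d) `^ beta by exact: powR_ge0.
(* [C1] is the a priori constant, [G] comes from the fundamental solution and (2/d)^beta from the
   dependence of z on E. One factor [c] bounds the weighted source [F], the other the sum of [h] and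
   the response [w']. *)
exists (C1 + G * (2 / d) `^ beta * c ^+ 2).
  by rewrite addr_ge0 ?(ltW C10) // !mulr_ge0.
move=> E E' z z' r A v v' B KE KE' jz jz' vB vB' hv hv'.
have A0 := nrm_ge0 A.
have vC n : nrm (v n) <= C1 * nrm A.
  exact: hC KE jz tV (bsum_delta r A) vB hv n.
have vC' n : nrm (v' n) <= C1 * nrm A.
  exact: hC KE' jz' tV (bsum_delta r A) vB' hv' n.
split=> n.
  by apply: le_trans (vC n) _; rewrite ler_wpM2r // lerDl !mulr_ge0.
have [z0 zE z1 _ _] := jz; have [z0' zE' z1' _ _] := jz'.
have [d1 d2 d3] := hd _ _ KE jz; have [_ _ d3'] := hd _ _ KE' jz'.
pose F k : Mat R L := delta_seq r A k - V k *m v' k.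
have CA0 : 0 <= C1 * nrm A by rewrite mulr_ge0 // ltW.
have wF : bsum (fun k => wt beta k * nrm (F k)) (c * wt beta r * nrm A).
  have wVv : bsum (fun k => wt beta k * nrm (V k *m v' k)) (C1 * nrm A * Q).
    apply: ler_bsum (bsumMl CA0 wVQ) => k.
    apply: le_trans (ler_wpM2l (wt_ge0 beta k) (ler_nrmM _ _)) _.
    by rewrite mulrA [leRHS]mulrC ler_wpM2l ?mulr_ge0 ?wt_ge0 ?nrm_ge0.
  move=> m; apply: le_trans (le_trans (ler_psum m _) (bsumD (bsum_wt_delta r A) wVv m)) _.
    move=> k; rewrite -mulrDr; apply: (ler_wpM2l (wt_ge0 beta k)); exact: ler_nrmB.
  rewrite /c !mulrDl mul1r lerD2l mulrAC -[leLHS]mulr1.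
  rewrite -[leRHS]mulrA [wt beta r * _]mulrC mulrA.
  by rewrite ler_wpM2l ?mulr_ge0 ?(ltW C10) // wt_ge1.
set H := G * cnorm (z - z') `^ beta * (c * wt beta r * nrm A).
pose h k := conv z F k - conv z' F k.
have hH k : nrm (h k) <= H * wt beta k.
  have := conv_hoelder k d0 z1 z1' d3 d3' wF; rewrite -/G => /le_trans; apply.
  by rewrite /H [leRHS]mulrAC.
have H0 : 0 <= H by rewrite !mulr_ge0 ?powR_ge0 ?wt_ge0.
have Vh : bsum (fun k => nrm (- (V k *m h k))) (H * Q).
  apply: ler_bsum (bsumMl H0 wVQ) => k; rewrite nrmN.
  apply: le_trans (ler_nrmM _ _) _; rewrite [leLHS]mulrC [leRHS]mulrA.
  exact: (ler_wpM2r (nrm_ge0 _) (hH k)).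
have bF : bsum (fun k => nrm (F k)) (nrm A + B * Q).
  exact: bsum_nrmB (bsum_delta r A) (bsum_pot (fun n => lexx _) bsum_V vB').
have bF' := bsum_nrmB (bsum_delta r A) (bsum_pot (fun n => lexx _) bsum_V vB).
pose w' k := v k - conv z F k.
have ww' k : v k - v' k = w' k + h k.
  by rewrite /w' /h (hv' k) addrA subrK.
have w'B k : nrm (w' k) <= B + (cnorm (z ^+ 2 - 1))^-1 * (nrm A + B * Q).
  by apply: le_trans (ler_nrmB _ _) _; apply: lerD => //; exact: nrm_conv_le.
(* The point source cancels between v and [conv z F], leaving -V (v - v') = -V h - V w' under the
   convolution. *)
have w'sol : sol V (fun k => - (V k *m h k)) z w'.
  move=> k; rewrite /w' {1}(hv k) -[LHS]/((fun k => conv z _ k - conv z F k) k).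
  rewrite -(convB z1 bF' bF); congr (conv z _ k); apply/funext => m.
  have -> : - (V m *m h m) - V m *m (v m - conv z F m) = - (V m *m (v m - v' m)).
    by rewrite ww' [in RHS]mulmxDr [in RHS]opprD [RHS]addrC.
  by rewrite /F mulmxBr opprB opprB addrC addrA subrK.
have w'C := hC _ _ _ _ _ _ _ KE jz tV Vh w'B w'sol n.
have wn1 := wt_ge1 n b0.
have step : nrm (v n - v' n) <= H * c * wt beta n.
  rewrite ww'; apply: le_trans (ler_nrmD _ _) _; apply: le_trans (lerD w'C (hH n)) _.
  rewrite /c mulrDr mulr1 mulrDl addrC lerD2l mulrCA.
  by rewrite -[leLHS]mulr1 ler_wpM2l // mulr_ge0 // mulr_ge0 // ltW.
apply: le_trans step _.
have zE2 : cnorm (z - z') `^ beta <= (2 / d) `^ beta * cnorm (E - E') `^ beta.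
  rewrite -powRM ?cnorm_ge0 ?divr_ge0 ?(ltW d0) //.
  apply: ge0_ler_powR; rewrite ?nnegrE ?mulr_ge0 ?cnorm_ge0 ?invr_ge0 ?(ltW d0) //.
  exact: jost_lipschitz jz jz' d0 d1 d2.
have -> : H * c * wt beta n =
    cnorm (z - z') `^ beta * (G * c ^+ 2 * wt beta r * wt beta n * nrm A).
  by rewrite /H expr2; ring.
have X0 : 0 <= G * c ^+ 2 * wt beta r * wt beta n * nrm A.
  by rewrite !mulr_ge0 ?wt_ge0 ?exprn_ge0.
apply: le_trans (ler_wpM2r X0 zE2) _.
rewrite [leLHS](_ : _ =
  G * (2 / d) `^ beta * c ^+ 2 * cnorm (E - E') `^ beta * wt beta r * wt beta n * nrm A); last by ring.
by rewrite !ler_wpM2r ?wt_ge0 ?powR_ge0 // lerDr ltW.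
Qed.

End Solutions.

(** * Boundary values of the resolvent kernel *)

Lemma subr_eq_swap (W : zmodType) (a1 a2 a3 a4 b1 b2 b3 b4 : W) :
  a1 + a2 + a3 - a4 = b1 + b2 + b3 - b4 ->
  a1 - b1 + (a2 - b2) + (a3 - b3) = a4 - b4.
Proof.
move=> /eqP; rewrite subr_eq => /eqP e.
rewrite [_ - b1 + _]addrACA -opprD [_ - (b1 + b2) + _]addrACA -opprD e.
by rewrite -[_ - b4 + a4]addrA [_ + (- b4 + a4)]addrC addrK addrC.
Qed.

Section Kernel.
Context {R : realType} {L : nat}.
Implicit Types (A : Mat R L) (f u v : Seq R L) (E z : Cplx R).

Lemma l2B u v : l2 u -> l2 v -> l2 (fun n => u n - v n).
Proof.
move=> /l2_bsum[M uM] /l2_bsum[M' vM']; apply/l2_bsum.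
pose c : R := 2 * ((L ^ 2)%:R * (L ^ 2)%:R).
have c0 : 0 <= c by rewrite !mulr_ge0.
exists (c * (M + M')); apply: ler_bsum (bsumMl c0 (bsumD uM vM')) => n.
have h : mat_norm (u n - v n) <= (L ^ 2)%:R * (mat_norm (u n) + mat_norm (v n)).
  apply: le_trans (mat_norm_le_nrm _) _; apply: le_trans (ler_nrmB _ _) _.
  by rewrite mulrDr; apply: lerD; exact: nrm_le_mat_norm.
have h2 : mat_norm (u n - v n) ^+ 2 <= ((L ^ 2)%:R * (mat_norm (u n) + mat_norm (v n))) ^+ 2.
  by rewrite ler_pXn2r ?nnegrE ?mulr_ge0 ?addr_ge0 ?mat_norm_ge0.
apply: le_trans h2 _; rewrite exprMn /c.
rewrite [leRHS](_ : _ = (L ^ 2)%:R ^+ 2 * (2 * (mat_norm (u n) ^+ 2 + mat_norm (v n) ^+ 2))).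
  apply: ler_wpM2l; first exact: sqr_ge0.
  move: (mat_norm _) (mat_norm _) => x y; have := sqr_ge0 (x - y); rewrite !expr2; lra.
by rewrite expr2 -!mulrA mulrCA; congr (_ * _); rewrite mulrCA.
Qed.

Variables (b : bool) (V : Seq R L) (beta Q : R).
Hypothesis hV : forall n, V n \is hermsymmx.
Hypothesis hbeta : 0 < beta <= 1.
Hypothesis wVQ : bsum (fun n => wt beta n * nrm (V n)) Q.

(** Off the cut |z| < 1, so v is in l2. The vector picked by [xget] solves the same equation, and a
    nonzero difference would be an eigenfunction. *)
Lemma resolvent_sol E z f v M B : limiting_set b V E -> ~ (-2 < E < 2) ->
  jost b E z -> bsum (fun n => nrm (f n)) M -> (forall n, nrm (v n) <= B) ->
  sol V f z v -> resolvent V E f = v.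
Proof.
move=> [_ _ _ nE] nseg jz fM vB hv.
have z1 := jost_cnorm_lt1 jz nseg.
have bF := bsum_nrmB fM (bsum_pot (fun n => lexx _) (bsum_V hbeta wVQ) vB).
have vE : l2 v /\ tau V v - E *: v = f.
  split; last exact: sol_tau jz bF hv.
  have [M' vM'] := conv_l1 z1 bF; apply: bsum_l2 vB _.
  by under eq_fun do rewrite hv; exact: vM'.
rewrite /resolvent; case: xgetP => [w _ [wl2 wE]|/(_ v)//].
apply: contrapT => wv; apply: nE; exists (fun n => w n - v n); split.
- exact: l2B wl2 vE.1.
- by apply/eqP => h; apply: wv; apply/funext => n; apply/eqP; rewrite -subr_eq0;
    apply/eqP; exact: (f_equal (fun g : Seq R L => g n) h).
apply/funext => n.
have e1 := f_equal (fun g : Seq R L => g n) wE.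
have e2 := f_equal (fun g : Seq R L => g n) vE.2.
have e3 : tau V w n - E *: w n = tau V v n - E *: v n by exact: etrans e1 (esym e2).
rewrite /tau mulmxBr -[RHS]/(E *: (w n - v n)) scalerBr.
exact: subr_eq_swap e3.
Qed.

(** On the cut, the solution at height e above or below E is the resolvent applied to the point
    source, and it differs from v by O(e^beta) at each fixed site. *)
Lemma bv_kernel_sol E z r A v B : limiting_set b V E -> jost b E z ->
  (forall n, nrm (v n) <= B) -> sol V (delta_seq r A) z v ->
  forall s, bv_kernel V b E s r A = v s.
Proof.
move=> hE jz vB hv s; have [sE E2 E2' nE] := hE.
rewrite /bv_kernel; case: ifPn => [seg|/negP nseg]; last first.
  by rewrite /op_kernel (resolvent_sol hE nseg jz (bsum_delta r A) vB hv).
move: (seg); rewrite in_segmentE => /andP[/eqP Im0 _].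
pose g (e : R) : Cplx R := E + (0 +i* ((-1) ^+ b * e)).
have gB e e' : cnorm (g e - g e') = `|e - e'|.
  rewrite /g opprD addrACA subrr add0r.
  rewrite -[X in cnorm X]/((0 - 0) +i* ((-1) ^+ b * e - (-1) ^+ b * e')).
  rewrite subr0 /= expr0n add0r sqrtr_sqr -mulrBr normrM normrX normrN1 expr1n.
  by rewrite mul1r.
have g0 : g 0 = E by rewrite /g mulr0 addr0.
have Img e : complex.Im (g e) = (-1) ^+ b * e.
  by rewrite /g raddfD /= Im0 add0r.
(* A closed segment is needed to have one Hoelder constant for all small e together with the end
   point E. *)
have cK : compact (g @` `[0, 1]).
  apply: continuous_compact; last exact: segment_compact.
  apply: continuous_subspaceT => e; apply/cvg_cnorm.
  under eq_fun do rewrite gB.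
  apply/cvgr0Pnorm_lt => eps eps0.
  have /cvgrPdist_lt/(_ _ eps0) : (fun t : R => t) @ e --> e by exact: cvg_id.
  by apply: filterS => t; rewrite normr_id distrC.
have lim e : 0 <= e -> limiting_set b V (g e).
  move=> e0; have [->|ne0] := eqVneq e 0; first by rewrite g0.
  have I0 : complex.Im (g e) != 0 by rewrite Img mulf_neq0 // signr_eq0.
  split.
  - by rewrite Img mulrA signb_sqr mul1r.
  - by apply: contraNneq I0 => ->; rewrite /= addr0.
  - by apply: contraNneq I0 => ->; rewrite /= addr0 oppr0.
  exact: not_eigenvalue_nonreal hV I0.
have KG : (g @` `[0, 1]) `<=` limiting_set b V.
  by move=> _ [e /= + <-]; rewrite in_itv /= => /andP[e0 _]; exact: lim.
have [C C0 hC] := sol_bound_hoelder hV hbeta wVQ cK KG.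
have Kg e : 0 <= e <= 1 -> (g @` `[0, 1]) (g e).
  by move=> he; exists e => //=; rewrite in_itv.
pose c := C * wt beta r * wt beta s * nrm A.
apply: nrm_cvg_lim.
have c0 : e `^ beta * c @[e --> 0^'+] --> 0.
  by apply: cvg0M; apply: powR_cvg0; case/andP: hbeta.
apply: (cvg0_le _ c0); near=> e.
have e0 : 0 < e by near: e; exact: nbhs_right_gt.
have e1 : e <= 1 by near: e; exact: nbhs_right_le.
have he := lim e (ltW e0).
have [sg g2 g2' _] := he; have [ze jze] := jost_exists sg g2 g2'.
have [ve [Be [veB hve]]] := sol_exists hV hbeta wVQ he jze (bsum_delta r A).
have nseg : ~ (-2 < g e < 2).
  rewrite in_segmentE Img mulf_eq0 signr_eq0 /= => /andP[/eqP ez _].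
  by rewrite ez ltxx in e0.
rewrite nrm_ge0 /= /op_kernel -/(g e) (resolvent_sol he nseg jze (bsum_delta r A) veB hve).
pose Bm := Num.max Be B.
have veBm n : nrm (ve n) <= Bm by rewrite le_max veB.
have vBm n : nrm (v n) <= Bm by rewrite le_max vB orbT.
have KE : (g @` `[0, 1]) E by rewrite -g0; apply: Kg; rewrite lexx ler01.
have Kge : (g @` `[0, 1]) (g e) by apply: Kg; rewrite ltW.
have [_ h] := hC _ _ _ _ _ _ _ _ _ Kge KE jze jz veBm vBm hve hv.
apply: le_trans (h s) _; rewrite -{1}g0 gB subr0 (gtr0_norm e0) /c.
by rewrite !mulrA [_ * C]mulrC.
Unshelve. all: by end_near. Qed.

End Kernel.

(** * Weighted operators *)

Section WeightedKernels.
Context {R : realType} {L : nat}.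
Implicit Types (A : Mat R L) (u v : Seq R L) (k : int -> int -> Mat R L -> Mat R L).
Variables (alpha beta S : R).
Hypothesis beta0 : 0 <= beta.
Hypothesis hS : bsum (fun n => wt (beta - alpha) n ^+ 2) S.

Definition kernel_op k u : Seq R L :=
  weight_op alpha (fun s => zsum (fun r => k s r (weight_op alpha u r))).

Lemma nrm_weight_op u n : nrm (weight_op alpha u n) = wt (- alpha) n * nrm (u n).
Proof.
rewrite /weight_op nrmZ; congr (_ * _).
by rewrite /= expr0n addr0 sqrtr_sqr ger0_norm ?powR_ge0.
Qed.

Lemma wt_mul n : wt (- alpha) n * wt beta n = wt (beta - alpha) n :> R.
Proof.
have n0 : 1 + `|n|%N%:R != 0 :> R.
  by rewrite lt0r_neq0 // (lt_le_trans ltr01) // wt_base_ge1.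
by rewrite /wt -powRD ?n0 ?implybT // [- alpha + _]addrC.
Qed.

(** A substitute for Cauchy-Schwarz based on x y <= x^2 + y^2; the factor [L ^ 2] converts
    [mat_norm] into [nrm]. *)
Definition cross_bound (c : R) : R := (L ^ 2)%:R ^+ 2 * c + S.

Lemma bsum_cross u c : bsum (fun n => mat_norm (u n) ^+ 2) c ->
  bsum (fun n => wt (beta - alpha) n * nrm (u n)) (cross_bound c).
Proof.
move=> uc; apply: ler_bsum (bsumD (bsumMl (sqr_ge0 (L ^ 2)%:R) uc) hS) => n.
apply: le_trans (mulr_le_sqrD _ _) _; rewrite lerD2r -exprMn.
by rewrite ler_pXn2r ?nnegrE ?nrm_ge0 ?mulr_ge0 ?mat_norm_ge0 // nrm_le_mat_norm.
Qed.

Section Bounded.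
Variables (k : int -> int -> Mat R L -> Mat R L) (D : R).
Hypothesis D0 : 0 <= D.
Hypothesis kD : forall s r A, nrm (k s r A) <= D * wt beta r * wt beta s * nrm A.

Lemma bsum_kernel u c s : bsum (fun n => mat_norm (u n) ^+ 2) c ->
  bsum (fun r => nrm (k s r (weight_op alpha u r))) (D * wt beta s * cross_bound c).
Proof.
move=> uc; have Dw : 0 <= D * wt beta s by rewrite mulr_ge0 ?wt_ge0.
apply: ler_bsum (bsumMl Dw (bsum_cross uc)) => r.
apply: le_trans (kD _ _ _) _; rewrite nrm_weight_op -wt_mul.
by rewrite [leLHS](_ : _ = D * wt beta s * (wt (- alpha) r * wt beta r * nrm (u r))) //; ring.
Qed.

(* Both weights factor out of the kernel bound, so that the operator is dominated
   by one of rank one. *)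
Lemma kernel_op_bound u : (l2norm u <= 1)%E ->
  (l2norm (kernel_op k u) <= (D * cross_bound 1 * (1 + S))%:E)%E.
Proof.
move=> /(l2norm_le_bsum u ler01); rewrite expr1n => uc.
have S0 := bsum_ge0 hS; set X := cross_bound 1.
have X0 : 0 <= X by rewrite addr_ge0 // mulr1 sqr_ge0.
apply/l2norm_le_bsum; first by rewrite !mulr_ge0 ?addr_ge0.
have DX0 : 0 <= (D * X) ^+ 2 by exact: sqr_ge0.
(* The total must be the square of the claimed bound, so S is enlarged to (1 + S)^2. *)
have h : bsum (fun n => (D * X) ^+ 2 * wt (beta - alpha) n ^+ 2) ((D * X * (1 + S)) ^+ 2).
  move=> N; apply: le_trans (bsumMl DX0 hS N) _.
  rewrite [leRHS]exprMn; apply: ler_wpM2l => //; rewrite expr2; nra.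
apply: ler_bsum h => s; rewrite -exprMn.
have DXw : 0 <= D * X * wt (beta - alpha) s by rewrite !mulr_ge0 ?wt_ge0.
rewrite ler_pXn2r ?nnegrE ?mat_norm_ge0 //.
apply: le_trans (mat_norm_le_nrm _) _; rewrite /kernel_op nrm_weight_op -wt_mul.
apply: le_trans (ler_wpM2l (wt_ge0 _ _) (nrm_zsum_le (bsum_kernel s uc))) _.
by rewrite [leLHS](_ : _ = D * X * (wt (- alpha) s * wt beta s)) // /X; ring.
Qed.

End Bounded.
End WeightedKernels.

Lemma closure_half_plane {R : realType} (b : bool) (E : Cplx R) :
  closure (half_plane b) E -> 0 <= (-1) ^+ b * complex.Im E.
Proof.
move=> cE; rewrite leNgt; apply/negP => neg.
pose r := - ((-1) ^+ b * complex.Im E); have r0 : 0 < r by rewrite oppr_gt0.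
have : nbhs E (ball E r%:C) by apply: nbhsx_ballx; rewrite ltcR.
move=> /cE[E' [/= E'h]]; rewrite /ball /= normr_cnormE ltcR => E'b.
have h : (-1) ^+ b * (complex.Im E' - complex.Im E) < r.
  apply: le_lt_trans E'b; apply: le_trans (ler_norm _) _.
  rewrite normrM normrX normrN1 expr1n mul1r -raddfB cnormBC; exact: Im_le_cnorm.
by move: h E'h; rewrite mulrBr /r /half_plane /=; lra.
Qed.

Unset Implicit Arguments.
Set Strict Implicit.
Set Printing Implicit Defensive.

Theorem theorem1p7 (R : realType) (L : nat) (hL : (1 <= L)%N)
    (V : Seq R L) (hV : forall n : int, V n \is hermsymmx)
    (rho alpha : R) (hrho : 0 < rho) (hVrho : (weighted_norm V rho < +oo)%E)
    (halpha : rho + 1 / 2 < alpha)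
    (b : bool) (K : set (Cplx R)) (hK : compact K)
    (hKsub : K `<=` closure (half_plane b)
                    `\` (point_spectrum V `|` [set -2; 2])) :
  (forall E : Cplx R, K E ->
     (forall u : Seq R L, l2 u ->
        bv_resolvent_dom V b E (weight_op alpha u)) /\
     bounded_on_l2 (weighted_bv_resolvent V b alpha E)) /\
  hoelder_on K (Num.min rho 1) (weighted_bv_resolvent V b alpha).
Proof.
set beta := Num.min rho 1.
have hb : 0 < beta <= 1 by rewrite lt_min hrho ltr01 ge_min lexx orbT.
have brho : beta <= rho by rewrite ge_min lexx.
have b0 : 0 <= beta by case/andP: hb => /ltW.
have KG : K `<=` limiting_set b V.
  move=> E /hKsub[cE /not_orP[nE /not_orP[E2 E2']]]; split=> //.
  - exact: closure_half_plane.
  - exact/eqP.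
  - exact/eqP.
have [Q wVQ] : exists Q, bsum (fun n => wt beta n * nrm (V n)) Q.
  have [n|M hM] := esum_lty_bsum _ hVrho; first by rewrite mulr_ge0 ?powR_ge0 ?mat_norm_ge0.
  exists ((L ^ 2)%:R * M); apply: ler_bsum (bsumMl (ler0n _ _) hM) => n.
  rewrite mulrCA; apply: ler_pM; rewrite ?wt_ge0 ?nrm_ge0 ?nrm_le_mat_norm //.
  by apply: ler_powR => //; exact: wt_base_ge1.
(* The exponent 2 (alpha - beta) exceeds 1 since alpha > rho + 1/2 >= beta + 1/2. *)
have [S hS] : exists S, bsum (fun n => wt (beta - alpha) n ^+ 2) S.
  have [|M hM] := @bsum_powR R (2 * (alpha - beta)); first lra.
  exists M; apply: ler_bsum hM => n.
  have n0 : 1 + `|n|%N%:R != 0 :> R.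
    by rewrite lt0r_neq0 // (lt_le_trans ltr01) // wt_base_ge1.
  have -> : - (2 * (alpha - beta)) = (beta - alpha) + (beta - alpha) by ring.
  by rewrite powRD ?n0 ?implybT // expr2.
have [C C0 hC] := sol_bound_hoelder hV hb wVQ hK KG.
have sol_ex E r A : K E -> exists v B z, [/\ jost b E z, (forall n, nrm (v n) <= B),
    sol V (delta_seq r A) z v & forall s, bv_kernel V b E s r A = v s].
  move=> KE; have hE := KG _ KE; have [sE E2 E2' _] := hE.
  have [z jz] := jost_exists sE E2 E2'.
  have [v [B [vB hv]]] := sol_exists hV hb wVQ hE jz (bsum_delta r A).
  exists v, B, z; split; [exact: jz|exact: vB|exact: hv|move=> s].
  exact: (bv_kernel_sol hV hb wVQ hE jz vB hv).
pose k E s r A := bv_kernel V b E s r A.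
(* Factors [wt beta] at least 1 are inserted so that boundedness and Hoelder continuity follow from
   the same operator estimate. *)
have kC E : K E -> forall s r A, nrm (k E s r A) <= C * wt beta r * wt beta s * nrm A.
  move=> KE s r A; have [v [B [z [jz vB hv kE]]]] := sol_ex E r A KE.
  have [h _] := hC _ _ _ _ _ _ _ _ _ KE KE jz jz vB vB hv hv.
  rewrite /k kE; apply: le_trans (h s) _; rewrite ler_wpM2r ?nrm_ge0 // -mulrA ler_peMr //.
  by rewrite mulr_ege1 ?wt_ge1.
have kh E E' : K E -> K E' -> forall s r A, nrm (k E s r A - k E' s r A) <=
    C * ComplexField.Normc.normc (E - E') `^ beta * wt beta r * wt beta s * nrm A.
  move=> KE KE' s r A; have [v [B [z [jz vB hv kE]]]] := sol_ex E r A KE.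
  have [v' [B' [z' [jz' vB' hv' kE']]]] := sol_ex E' r A KE'.
  have vm n : nrm (v n) <= Num.max B B' by rewrite le_max vB.
  have vm' n : nrm (v' n) <= Num.max B B' by rewrite le_max vB' orbT.
  have [_ h] := hC _ _ _ _ _ _ _ _ _ KE KE' jz jz' vm vm' hv hv'.
  by rewrite /k kE kE'; exact: h.
(* The kernel is given by a choice or a limit, so its linearity is obtained from that of [sol] and
   the identification of every bounded solution with the kernel. *)
have klin E : K E -> forall s r (a : Cplx R) A A',
    k E s r (a *: A + A') = a *: k E s r A + k E s r A'.
  move=> KE s r a A A'; have hE := KG _ KE; have [sE E2 E2' _] := hE.
  have [z jz] := jost_exists sE E2 E2'.
  have [v [B [vB hv]]] := sol_exists hV hb wVQ hE jz (bsum_delta r A).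
  have [v' [B' [vB' hv']]] := sol_exists hV hb wVQ hE jz (bsum_delta r A').
  have [_ _ z1 _ _] := jz.
  have VQ := bsum_V hb wVQ.
  have := sol_linear a z1 VQ (bsum_delta r A) (bsum_delta r A') vB vB' hv hv'.
  have -> : (fun n => a *: delta_seq r A n + delta_seq r A' n) = delta_seq r (a *: A + A').
    by apply/funext => n; rewrite /delta_seq; case: eqP => // _; rewrite scaler0 addr0.
  have wB n : nrm (a *: v n + v' n) <= cnorm a * B + B'.
    by apply: le_trans (ler_nrmD _ _) _; rewrite nrmZ lerD // ler_wpM2l ?cnorm_ge0.
  move=> hw; rewrite /k (bv_kernel_sol hV hb wVQ hE jz wB hw).
  by rewrite (bv_kernel_sol hV hb wVQ hE jz vB hv) (bv_kernel_sol hV hb wVQ hE jz vB' hv').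
have Tk E u : weighted_bv_resolvent V b alpha E u = kernel_op alpha (k E) u by [].
have sumk E s u c : K E -> bsum (fun n => mat_norm (u n) ^+ 2) c ->
    bsum (fun r => nrm (k E s r (weight_op alpha u r))) (C * wt beta s * @cross_bound R L S c).
  by move=> KE uc; exact: (bsum_kernel hS C0 (kC E KE) s uc).
split=> [E KE|].
  split=> [u /l2_bsum[c uc] s|].
    rewrite /summable; apply: (@le_lt_trans _ _ (C * wt beta s * @cross_bound R L S c)%:E).
      have -> : (fun r => (`|(mat_norm (bv_kernel V b E s r (weight_op alpha u r)))%:E|)%E) =
        (fun r => (mat_norm (bv_kernel V b E s r (weight_op alpha u r)))%:E).
        by apply/funext => r; rewrite /= ger0_norm ?mat_norm_ge0.
      apply/esum_le_bsum => [r|]; first exact: mat_norm_ge0.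
      by apply: ler_bsum (sumk E s u c KE uc) => r; exact: mat_norm_le_nrm.
    by rewrite ltry.
  split=> [a u v /l2_bsum[c uc] /l2_bsum[c' vc']|].
    rewrite !Tk; apply/funext => s.
    rewrite -[RHS]/(a *: kernel_op alpha (k E) u s + kernel_op alpha (k E) v s).
    rewrite /kernel_op /weight_op scalerA mulrC -scalerA -scalerDr; congr (_ *: _).
    have b1 := sumk E s u c KE uc; have b2 := sumk E s v c' KE vc'.
    rewrite -(zsumZ _ b1) -(zsumD _ b2
      (M := cnorm a * (C * wt beta s * @cross_bound R L S c))); last first.
      exact: (@bsum_scale _ _ (cnorm a) (fun=> a) _ _ (fun=> lexx _) b1).
    congr zsum; apply/funext => r; rewrite -klin //; congr (k E s r _).
    by rewrite scalerDr !scalerA mulrC.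
  apply: (@le_lt_trans _ _ (C * @cross_bound R L S 1 * (1 + S))%:E); last by rewrite ltry.
  apply: ge_ereal_sup => _ [u /= u1 <-]; rewrite Tk.
  exact: (kernel_op_bound hS C0 (kC E KE)).
exists (C * @cross_bound R L S 1 * (1 + S)) => E E' KE KE'.
apply: ge_ereal_sup => _ [u /= u1 <-].
have D0 : 0 <= C * ComplexField.Normc.normc (E - E') `^ beta by rewrite mulr_ge0 ?powR_ge0.
have uc : bsum (fun n => mat_norm (u n) ^+ 2) 1.
  by have := (l2norm_le_bsum u ler01).1 u1; rewrite expr1n.
have -> : weighted_bv_resolvent V b alpha E u - weighted_bv_resolvent V b alpha E' u =
    kernel_op alpha (fun s r A => k E s r A - k E' s r A) u.
  rewrite !Tk; apply/funext => s.
  rewrite -[LHS]/(kernel_op alpha (k E) u s - kernel_op alpha (k E') u s).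
  rewrite /kernel_op /weight_op -scalerBr; congr (_ *: _).
  by rewrite -(zsumB (sumk E s u 1 KE uc) (sumk E' s u 1 KE' uc)).
apply: le_trans (kernel_op_bound hS D0 (kh E E' KE KE') u1) _.
by rewrite lee_fin [leLHS](_ : _ =
  C * @cross_bound R L S 1 * (1 + S) * ComplexField.Normc.normc (E - E') `^ beta) //; ring.
Qed.
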